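(* For $n\ge2$ set $a_n:=\int_{1/n}^1\frac{1-t}{t}\,dt=\ln n-1+\frac1n$ and let $$\lambda_0^n=\frac{1}{1+a_n},\qquad \lambda_n(t)=\lambda_0^n(t-1),\qquad z_n(t)=\lambda_0^n\,\frac{1-t}{t}\qquad(t\in[1/n,1]),\qquad \zeta_n=0,\quad \beta_n\equiv0,$$ which are the multipliers of the truncated problem $(E_n)$ at its minimizer $(t^2/2,t)$ normalized by $\lambda_0^n+\|z_n\|_{L^1}=1$. Extend $z_n$ by zero to $[0,1]$ and let $\mu_n$ be the measure $d\mu_n=z_n(t)\,dt$ on $\mathfrak L$. Then $$\lambda_0^n=\Bigl(\ln n+\frac1n\Bigr)^{-1}\to0,\qquad \|\lambda_n\|_{L^\infty}=\lambda_0^n\Bigl(1-\frac1n\Bigr)\to0,\qquad \|z_n\|_{L^1}\to1,$$ while, for every $\varepsilon\in(0,1)$, $\mu_n([\varepsilon,1])\le\lambda_0^n\ln(1/\varepsilon)\to0$. Moreover: (i) no subsequence of $(z_n)$ converges weakly in $L^1([0,1];\mathbb R)$; (ii) regarded as Borel measures, $\mu_n\rightharpoonup\delta_0$ in the weak$^*$ topology of $C([0,1];\mathbb R)^*$, where $\delta_0$ is the Dirac measure at the origin; however, $\delta_0$ fails to be weakly absolutely continuous with respect to Lebesgue measure (and is therefore not an admissible multiplier); (iii) the sequence $(\mu_n)$ has no limit in the weak$^*$ topology of $L^\infty([0,1];\mathbb R)^*$: for $\psi(t)=\sin(\ln\ln(e/t))$, $t\in(0,1]$, the sequence $\bigl(\int_0^1\psi\,d\mu_n\bigr)$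 clusters at every point of $[-\tfrac{\sqrt2}{2},\tfrac{\sqrt2}{2}]$; (iv) for every Banach limit $\operatorname{B-lim}$, the set function $\omega(E):=\operatorname{B-lim}_n\,\mu_n(E)$, $E\in\mathfrak L$, is a positive pure charge in $\operatorname{ba}$, concentrated at the origin (i.e. $\omega((0,\varepsilon))=\omega([0,1])$ for all $\varepsilon>0$) and with $\omega([0,1])=1$. Every weak$^*$ cluster point of $(\mu_n)$ in $L^\infty([0,1];\mathbb R)^*$ enjoys the same properties. Consequently, every generalized limit of these normalized multipliers, whether a Banach limit or a weak$^*$ cluster point along a subnet, is a tuple of degenerate multipliers; i.e. it has the form $\lambda=\beta=0$, $\lambda_0=0$, $z=0$, $\zeta=\omega$ with $\omega$ (the corresponding generalized limit of $(\mu_n)$) a pure charge as in (iv).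
   Context: ''a.e.'' refers to Lebesgue measure; $\mathfrak L$ is the $\sigma$-algebra of Lebesgue measurable subsets of $[0,1]$. Problem (E): minimize $-\int_0^1x(t)\,dt$ over $(x,u)\in W^{1,1}([0,1];\mathbb R)\times L^\infty([0,1];\mathbb R)$ subject to $\dot x=u$ a.e., $tu(t)-t^2\le0$ a.e., $x(0)=0$; its unique minimizer is $(t^2/2,t)$. Problem $(E_n)$, $n\ge2$: the same cost integrand, dynamics and constraint on $[1/n,1]$, i.e. minimize $-\int_{1/n}^1x\,dt$ with initial condition $x(1/n)=1/(2n^2)$. A charge is a finitely additive set function on $\mathfrak L$ vanishing at $\emptyset$. $\operatorname{ba}$ denotes the bounded charges that are weakly absolutely continuous with respect to Lebesgue measure, i.e. vanish on Lebesgue null sets; it is isometrically isomorphic to $L^\infty([0,1];\mathbb R)^*$ (total variation norm), a charge acting by integration. A positive charge $\zeta$ is pure if the only countably additive measure $\mu$ with $0\le\mu\le\zeta$ is $\mu=0$. By the Yosida–Hewitt decomposition each $\omega\in\operatorname{ba}$ is uniquely $d\omega=z\,dt+d\zeta$ with $z\in L^1$ and $\zeta$ pure in $\operatorname{ba}$; a generalized limit of the densities $z_n$ (i.e. of $\mu_n$) is interpreted through this decomposition. A Banach limit is a linear functional $\operatorname{B-lim}$ on $\ell^\infty(\mathbb R)$ that is positive ($\operatorname{B-lim}x_i\ge0$ if all $x_i\ge0$), normalized ($\operatorname{B-lim}(1,1,\dots)=1$) and shift invariant ($\operatorname{B-lim}x_i=\operatorname{B-lim}x_{i+1}$); sequences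 indexed by $n\ge2$ are reindexed. A tuple $(\lambda,\beta,\lambda_0,z,\zeta)$ is degenerate if $\lambda_0=0$, $z\equiv0$, and there are $t^*\in[0,1]$ and $\alpha$ with $\lambda(t)=-\beta(t)=\alpha$ for $t<t^*$ and $=0$ for $t\ge t^*$, and $\zeta$ is a pure charge in $\operatorname{ba}$ concentrated at $t^*$ from the right ($\zeta((t^*,t^*+\varepsilon))=\zeta([0,1])$ for all $\varepsilon>0$) or from the left ($\zeta((t^*-\varepsilon,t^* ))=\zeta([0,1])$ for all $\varepsilon>0$), intervals intersected with $[0,1]$. (When $t^*=0$, the value at the single instant $0$ is $\lambda(0)=-\beta(0)=\int_0^1\bar g_x\,d\zeta$; for (E) $\bar g_x\equiv0$, so it is $0$.) *)

(* Defs.v *)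
From HB Require Import structures.
From mathcomp Require Import all_boot all_order all_algebra.
From mathcomp Require Import all_classical all_reals all_analysis.
From mathcomp Require Import measurable_realfun.
Set Implicit Arguments.
Unset Strict Implicit.
Unset Printing Implicit Defensive.
Import Order.TTheory GRing.Theory Num.Theory.
Import numFieldNormedType.Exports HBSimple.
Local Open Scope classical_set_scope.
Local Open Scope ring_scope.

(* The real line with the sigma-algebra of Lebesgue measurable sets. It is
   convertible to R, but carries a different measurable structure. *)
Definition lebT (R : realType) : Type :=
  caratheodory_type (mu_ext (@wlength R idfun)).
HB.instance Definition _ (R : realType) := Measurable.on (lebT R).

Definition leb {R : realType} : set (lebT R) -> \bar R :=
  completed_lebesgue_measure.
HB.instance Definition _ (R : realType) := Measure.on (@leb R).

Lemma measurable_leb (R : realType) (A : set R) :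
  measurable (A : set (measurableTypeR R)) -> measurable (A : set (lebT R)).
Proof. exact: sub_caratheodory. Qed.

(* The measure space ([a, b], Lebesgue sets, dt) is represented by the measure
   on the line that is Lebesgue measure on [a, b] and vanishes outside: sets and
   functions are understood up to what they do off [a, b]. *)
Definition lebI (R : realType) (a b : R) : set (lebT R) -> \bar R :=
  mrestr leb (measurable_leb (measurable_itv `[a, b])).
HB.instance Definition _ (R : realType) (a b : R) := Measure.on (lebI a b).

Notation leb01 R := (@lebI R 0 1).

(* Essentially bounded, resp. integrable, functions on [0, 1]. These are types
   of functions, not of classes, but every functional below is bounded for the
   norm, hence only depends on the class. *)
Notation L1 R := (LfunType (leb01 R) (lexx 1%E)).
Notation Linf R := (LfunType (leb01 R) (leey 1%E)).

Definition Lfun_dual d (T : measurableType d) (R : realType)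
    (mu : {measure set T -> \bar R}) (p : \bar R) (p1 : (1 <= p)%E)
    (Phi : LfunType mu p1 -> R) : Prop :=
  scalar Phi /\
  exists M : R, forall f, (`|Phi f|%:E <= M%:E * 'N[mu]_p[EFin \o f])%E.

Definition weak_cvg_L1 (R : realType) (u : nat -> R -> R) (f : R -> R) : Prop :=
  exists (U : nat -> L1 R) (F : L1 R),
    [/\ forall k, (U k : R -> R) = u k, (F : R -> R) = f &
        forall Phi : L1 R -> R, Lfun_dual Phi ->
          (fun k => Phi (U k)) @ \oo --> Phi F].

Section charges.
Context {R : realType}.
Local Open Scope ereal_scope.
Implicit Types w zeta : {additive_charge set (lebT R) -> \bar R}.

(* Domination by leb01 also forces the charge to vanish off [0, 1]. *)
Definition ba w : Prop :=
  w `<< leb01 R /\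
  exists M : R, forall E, measurable E -> `|w E| <= M%:E.

Definition positive_pure (v : set (lebT R) -> \bar R) : Prop :=
  (forall E, measurable E -> 0 <= v E) /\
  forall m : {measure set (lebT R) -> \bar R},
    (forall E, measurable E -> m E <= v E) ->
    forall E, measurable E -> m E = 0.

Definition charge_pos (v : set (lebT R) -> \bar R) (E : set (lebT R)) : \bar R :=
  ereal_sup (v @` [set F | measurable F /\ F `<=` E]).

(* A signed charge is pure when both parts of its Jordan decomposition are. *)
Definition pure v : Prop :=
  positive_pure (charge_pos v) /\ positive_pure (charge_pos (fun E => - v E)).

Definition yosida_hewitt w (z : R -> R) zeta : Prop :=
  [/\ z \in Lfun (leb01 R) 1, ba zeta, pure zeta &
      forall E : set (lebT R), measurable E ->
        w E = \int[leb01 R]_(t in E) (z t)%:E + zeta E].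

(* The integral of f against w is the limit of the integrals of the simple
   functions as these approach f uniformly up to null sets. *)
Definition charge_integral_is w (f : lebT R -> R) (I : R) : Prop :=
  forall e : R, (0 < e)%R -> exists2 d : R, (0 < d)%R &
    forall s : {sfun lebT R >-> R},
      'N[leb01 R]_+oo[EFin \o (f \- s)%R] < d%:E ->
      (`|fine (sintegral w s) - I| < e)%R.

Definition represents w (Phi : Linf R -> R) : Prop :=
  forall psi : Linf R, charge_integral_is w psi (Phi psi).

Definition pure_at_origin w : Prop :=
  [/\ ba w, positive_pure w,
      forall e : R, (0 < e)%R ->
        w (`]0%R, e[%classic : set R) = w (`[0%R, 1%R]%classic : set R) &
      w (`[0%R, 1%R]%classic : set R) = 1].

End charges.

Definition banach_limit (R : realType) (B : (nat -> R) -> R) : Prop :=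
  [/\ forall (a : R) (u v : nat -> R), bounded_fun u -> bounded_fun v ->
        B (fun k => a * u k + v k) = a * B u + B v,
      forall u : nat -> R, bounded_fun u -> (forall k, 0 <= u k) -> 0 <= B u,
      B (fun=> 1) = 1 &
      forall u : nat -> R, bounded_fun u -> B (fun k => u k.+1) = B u].

Definition degenerate (R : realType) (lambda beta : R -> R) (lambda0 : R)
    (z : R -> R) (zeta : {additive_charge set (lebT R) -> \bar R}) : Prop :=
  [/\ lambda0 = 0, (\forall t \ae leb01 R, z t = 0) &
      exists ts alpha : R,
      [/\ 0 <= ts <= 1,
          forall t, 0 <= t <= 1 -> t < ts -> lambda t = alpha /\ - beta t = alpha,
          forall t, 0 <= t <= 1 -> ts <= t -> lambda t = 0 /\ - beta t = 0,
          ba zeta /\ positive_pure zeta &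
          (forall e : R, 0 < e ->
             zeta (`]ts, ts + e[%classic : set R) = zeta (`[0, 1]%classic : set R)) \/
          (forall e : R, 0 < e ->
             zeta (`]ts - e, ts[%classic : set R) = zeta (`[0, 1]%classic : set R))]].

Section problem.
Context {R : realType}.
Implicit Types (a : R) (x u v lambda z : R -> R).

(* x is (the continuous representative of) an element of W^{1,1}([a, 1]) whose
   derivative is a.e. v. *)
Definition W11 a x v : Prop :=
  leb.-integrable (`[a, 1]%classic : set R) (EFin \o v) /\
  forall t, a <= t <= 1 -> x t = x a + \int[leb]_(s in (`[a, t]%classic : set R)) v s.

(* The full problem is a = 0, the truncated ones are a = 1/n; the initial value
   1/(2n^2) is a^2/2. *)
Definition admissible a x u : Prop :=
  [/\ u \in Lfun (lebI a 1) +oo%E, W11 a x u,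
      (\forall t \ae lebI a 1, (t : R) * u t - (t : R) ^+ 2 <= 0) &
      x a = a ^+ 2 / 2].

Definition cost a x : R := - \int[leb]_(t in (`[a, 1]%classic : set R)) x t.

Definition unique_minimizer a x u : Prop :=
  admissible a x u /\
  forall x' u', admissible a x' u' ->
    cost a x <= cost a x' /\
    (cost a x' = cost a x ->
       (forall t, a <= t <= 1 -> x' t = x t) /\
       (\forall t \ae lebI a 1, u' t = u t)).

(* First-order conditions at an admissible control u, with vanishing singular
   parts (beta = 0, zeta = 0), for the Lagrangian -lambda0 x, the dynamics u and
   the constraint g(t, u) = t u - t^2: adjoint equation
   lambda' = -(-lambda0) and transversality lambda(1) = 0, stationarity
   lambda + z g_u = 0, sign and complementarity z >= 0, z g = 0. *)
Definition regular_multipliers a u (lambda0 : R) lambda z : Prop :=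
  [/\ 0 <= lambda0,
      W11 a lambda (fun=> lambda0) /\ lambda 1 = 0,
      z \in Lfun (lebI a 1) 1%E,
      (\forall t \ae lebI a 1,
         0 <= z t /\ z t * ((t : R) * u t - (t : R) ^+ 2) = 0) &
      (\forall t \ae lebI a 1, lambda t + (t : R) * z t = 0)].

End problem.

Section truncated_multipliers.
Context (R : realType).

Definition a_ (n : nat) : R :=
  \int[leb]_(t in (`[n%:R^-1, 1] : set R)) ((1 - (t : R)) / (t : R)).

Definition lambda0_ (n : nat) : R := (1 + a_ n)^-1.

Definition lambda_ (n : nat) (t : R) : R :=
  if n%:R^-1 <= t <= 1 then lambda0_ n * (t - 1) else 0.

Definition z_ (n : nat) (t : R) : R :=
  if n%:R^-1 <= t <= 1 then lambda0_ n * ((1 - t) / t) else 0.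

Definition beta_ (n : nat) (t : R) : R := 0.

Definition mu_ (n : nat) (E : set (lebT R)) : \bar R :=
  (\int[leb01 R]_(t in E) (z_ n t)%:E)%E.

End truncated_multipliers.

Arguments lambda_ : clear implicits.
Arguments z_ : clear implicits.
Arguments beta_ : clear implicits.
Arguments mu_ : clear implicits.

Section mu_measure.
Context (R : realType) (n : nat).

Lemma lambda0__ge0 : 0 <= lambda0_ R n.
Proof.
rewrite /lambda0_ invr_ge0 addr_ge0//; apply: Rintegral_ge0 => t /=.
rewrite in_itv /= => /andP[nt t1].
by rewrite divr_ge0 ?subr_ge0// (le_trans _ nt)// invr_ge0.
Qed.

Lemma z__ge0 (t : R) : 0 <= z_ R n t.
Proof.
rewrite /z_; case: ifPn => // /andP[nt t1].
rewrite mulr_ge0 ?lambda0__ge0// divr_ge0 ?subr_ge0//.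
by rewrite (le_trans _ nt)// invr_ge0.
Qed.

Lemma measurable_invr : measurable_fun [set: measurableTypeR R]
  (@GRing.inv R : measurableTypeR R -> R).
Proof.
have <- : [set 0 : R] `|` ~` [set 0] = setT by exact: setUv.
apply/measurable_funU; [by []|exact/measurableC|].
split; first exact: measurable_fun_set1.
apply: open_continuous_measurable_fun.
  by rewrite openC; exact: closed_eq.
by move=> t /set_mem /eqP t0; exact: inv_continuous.
Qed.

Lemma measurable_z_ : measurable_fun [set: lebT R] (z_ R n : lebT R -> R).
Proof.
have mz : measurable_fun [set: measurableTypeR R]
    (z_ R n : measurableTypeR R -> R).
  apply: measurable_fun_ifT.
  - by apply: measurable_and; exact: measurable_fun_ler.
  - apply: measurable_funM => //; apply: measurable_funM.
      exact: measurable_funB.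
    exact: measurable_invr.
  - by [].
move=> _ Y mY; rewrite setTI; apply: measurable_leb.
by have := mz measurableT Y mY; rewrite setTI.
Qed.

Let mu_0 : mu_ R n set0 = 0%E. Proof. exact: integral_set0. Qed.

Let mu_ge0 E : (0 <= mu_ R n E)%E.
Proof. by apply: integral_ge0 => t _; rewrite lee_fin z__ge0. Qed.

Let mu_sigma_additive : semi_sigma_additive (mu_ R n).
Proof.
apply: semi_sigma_additive_nng_induced.
- exact/measurable_EFinP/measurable_z_.
- by move=> t; rewrite lee_fin z__ge0.
Qed.

HB.instance Definition _ := isMeasure.Build _ _ _ (mu_ R n)
  mu_0 mu_ge0 mu_sigma_additive.

End mu_measure.

Section generalized_limits.
Context {R : realType}.
Implicit Types (w zeta : {additive_charge set (lebT R) -> \bar R}).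
Implicit Types (Phi : Linf R -> R) (F : set_system nat).

Definition int_mu (n : nat) (psi : Linf R) : R := \int[mu_ R n]_t psi t.

(* The weak* topology of the dual of Linf is induced by pointwise convergence. *)
Definition weakstar_cvg F (u : nat -> Linf R -> R) Phi : Prop :=
  Lfun_dual Phi /\ {ptws, u @ F --> Phi}.

Definition weakstar_cluster (u : nat -> Linf R -> R) Phi : Prop :=
  Lfun_dual Phi /\
  cluster ((u : nat -> {ptws Linf R -> R}) @ \oo) (Phi : {ptws Linf R -> R}).

(* The sequences start at n = 2. *)
Definition blim (B : (nat -> R) -> R) (u : nat -> R) : R := B (fun k => u k.+2).

Definition banach_charge (B : (nat -> R) -> R) w : Prop :=
  forall E : set (lebT R), measurable E ->
    w E = (blim B (fun n => fine (mu_ R n E)))%:E.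

(* Subnets of a sequence are encoded by the proper filters finer than \oo. *)
Definition subnet F : Prop := ProperFilter F /\ \oo `<=` F.

(* (lambda, beta, lambda0, z, zeta) is a generalized limit of
   (lambda_ n, beta_ n, lambda0_ n, z_ n, 0), where Lim u l means that the real
   sequence u has generalized limit l, and w is the generalized limit of mu_ n.
   Pointwise limits of lambda_ and beta_ are the weakest choice. *)
Definition generalized_limit (Lim : (nat -> R) -> R -> Prop) w
    (lambda beta : R -> R) (lambda0 : R) (z : R -> R) zeta : Prop :=
  [/\ forall t, 0 <= t <= 1 -> Lim (fun n => lambda_ R n t) (lambda t),
      forall t, 0 <= t <= 1 -> Lim (fun n => beta_ R n t) (beta t),
      Lim (lambda0_ R) lambda0 &
      yosida_hewitt w z zeta].

Definition banach_generalized_limit (B : (nat -> R) -> R) w :=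
  generalized_limit (fun u l => blim B u = l) w.

Definition subnet_generalized_limit F w :=
  generalized_limit (fun u l => u @ F --> l) w.

Definition trivial_multipliers w (lambda beta : R -> R) (lambda0 : R)
    (z : R -> R) zeta : Prop :=
  [/\ forall t, 0 <= t <= 1 -> lambda t = 0 /\ beta t = 0,
      lambda0 = 0, (\forall t \ae leb01 R, z t = 0) &
      forall E : set (lebT R), measurable E -> zeta E = w E].

End generalized_limits.

(* Main.v *)
(** In the logarithmic variable [s = ln (1 / t)] the normalized densities [z_n]
    are essentially [ds / ln n] on [0, ln n]: their total mass tends to 1 while
    the mass of every [e, 1] tends to 0, so all the mass escapes to the origin.
    Testing with indicators of [e, 1] and of [0, 1] excludes a weak limit in L1,
    and a continuous function only sees its value at 0.  For
    [psi = sin (ln (ln (e / t)))] the antiderivative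
    [v / 2 * (sin (ln v) - cos (ln v))] of [sin (ln v)], [v = ln (e / t)], shows
    that the integral of [psi] is [(sin v - cos v) / 2] at [v = ln (1 + ln n)] up
    to an error [3 * lambda0_n]; since [ln (1 + ln n)] tends to infinity with
    vanishing increments, every value of [(sin v - cos v) / 2] is a cluster point.

    A Banach limit or a weak* cluster point of [mu_n] vanishes on null sets and on
    every [e, 1].  A measure below such a charge vanishes on the countably many
    sets [1/k, 1], on the null set {0} and off [0, 1], hence is zero: the charge
    is pure.

    In the truncated problem [t u <= t ^ 2] with [t >= a > 0] is [u <= t], so the
    trajectory [t ^ 2 / 2] dominates every other one; the adjoint equation and
    stationarity determine [lambda] and [z] up to the factor [lambda0]. *)
Require Import Defs.
From HB Require Import structures.
From mathcomp Require Import all_boot all_order all_algebra.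
From mathcomp Require Import all_classical all_reals all_analysis.
From mathcomp Require Import measurable_realfun ess_sup_inf ring lra.
Set Implicit Arguments.
Unset Strict Implicit.
Unset Printing Implicit Defensive.
Import Order.TTheory GRing.Theory Num.Theory.
Import numFieldNormedType.Exports HBSimple.
Local Open Scope classical_set_scope.
Local Open Scope ring_scope.

(** * Lebesgue integrals on the completed sigma-algebra *)

(** Charges, null sets and the measures [mu_ n] live on the completed sigma-algebra, while the
    fundamental theorem of calculus speaks of the Borel line; explicit integrals therefore cross
    over through [integral_leb]. A Banach limit and a weak* cluster point have no common formula,
    but both agree with the ordinary limit wherever one exists. The masses of null sets, of [e, 1]
    and of [0, 1] do converge, to 0, 0 and 1, and with positivity these values alone yield purity
    and concentration; one criterion, [pure_at_originI], thus serves both. The function [psi] must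
    keep oscillating after averaging. In the variable v the average of v^i over [1, V] is about V^i
    / (1 + i): it turns with V forever and only loses the factor |1 / (1 + i)| = sqrt 2 / 2, the
    endpoint of the interval of cluster points. The imaginary part of V^i / (1 + i) is [osc (ln V)].
    A generalized limit comes with some Yosida-Hewitt decomposition, so calling it degenerate takes
    uniqueness of that decomposition, which is proved for charges pure at the origin. *)

Section measure_transfer.
Context (R : realType).
Local Open Scope ereal_scope.

Let id_leb (t : lebT R) : measurableTypeR R := t.

Let measurable_id_leb : measurable_fun setT id_leb.
Proof. by move=> _ Y mY; rewrite setTI; exact: measurable_leb. Qed.

(** The identity from the completed to the Borel sigma-algebra is measurable and pushes [leb]
    forward to [lebesgue_measure]. Change of variables settles nonnegative integrands; the signed
    case follows by positive and negative parts. *)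
Lemma integral_leb (D : set (measurableTypeR R)) (f : measurableTypeR R -> \bar R) :
  measurable D -> measurable_fun D f ->
  \int[leb]_(t in (D : set (lebT R))) f t = \int[lebesgue_measure]_(t in D) f t.
Proof.
move=> mD mf.
have ge0 g : measurable_fun D (g : measurableTypeR R -> \bar R) ->
    (forall t, 0 <= g t) ->
  \int[leb]_(t in (D : set (lebT R))) g t = \int[lebesgue_measure]_(t in D) g t.
  move=> mg g0.
  transitivity (\int[pushforward leb id_leb]_(t in D) g t).
    by rewrite (ge0_integral_pushforward measurable_id_leb).
  by apply: eq_measure_integral => A _ _.
rewrite integralE [RHS]integralE !ge0//.
- exact: measurable_funeneg.
- exact: measurable_funepos.
Qed.

Lemma lebIE (a b : R) (A : set (lebT R)) :
  lebI a b A = leb (A `&` (`[a, b]%classic : set R)).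
Proof. by []. Qed.

Lemma integral_lebI (a b : R) (E : set (lebT R)) (f : lebT R -> \bar R) :
  measurable E -> measurable_fun E f ->
  \int[lebI a b]_(t in E) f t =
  \int[leb]_(t in E `&` (`[a, b]%classic : set R)) f t.
Proof.
move=> mE mf.
have mab := measurable_leb (measurable_itv `[a, b]).
have ge0 g : measurable_fun E g -> (forall t, 0 <= g t) ->
  \int[lebI a b]_(t in E) g t =
  \int[leb]_(t in E `&` (`[a, b]%classic : set R)) g t.
  move=> mg g0.
  rewrite -[in LHS](setUIDK E (`[a, b]%classic : set R)).
  rewrite ge0_integral_setU//; last 4 first.
  - exact: measurableI.
  - exact: measurableD.
  - by rewrite setUIDK.
  - by apply/disj_setPS => t [[_ h] [_]].
  rewrite [X in _ + X](_ : _ = 0) ?adde0; last first.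
    rewrite (eq_measure_integral mzero) ?integral_measure_zero// => A mA AE.
    rewrite [LHS]lebIE (_ : A `&` _ = set0) ?measure0//.
    by apply/seteqP; split => // t [/AE[_ h] /h].
  apply: eq_measure_integral => A mA AE.
  by rewrite [LHS]lebIE setIidl// => t /AE[].
rewrite integralE [RHS]integralE !ge0//.
- exact: measurable_funeneg.
- exact: measurable_funepos.
Qed.
End measure_transfer.

Lemma measurable_fun_leb (R : realType) d (Y : measurableType d)
    (D : set (measurableTypeR R)) (f : measurableTypeR R -> Y) :
  measurable D -> measurable_fun D f ->
  measurable_fun (D : set (lebT R)) (f : lebT R -> Y).
Proof. by move=> mD mf _ B mB; apply: measurable_leb; exact: mf. Qed.

(** * Integration against a measure given by a density *)

Section density.
Import HBNNSimple.
Context d (T : measurableType d) (R : realType).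
Local Open Scope ereal_scope.
Variables (mu nu : {measure set T -> \bar R}) (z : T -> R).
Hypotheses (mz : measurable_fun setT z) (z0 : forall t, (0 <= z t)%R).
Hypothesis nuE : forall A, measurable A -> nu A = \int[mu]_(t in A) (z t)%:E.

(** The density formula is assumed on sets only. Both sides are limits along the same increasing
    approximation by simple functions, and on a level set the identity is [nuE]. *)
Lemma ge0_integral_density (E : set T) (f : T -> \bar R) :
  measurable E -> measurable_fun E f -> (forall t, 0 <= f t) ->
  \int[nu]_(t in E) f t = \int[mu]_(t in E) (f t * (z t)%:E).
Proof.
move=> mE mf f0.
have mzE : measurable_fun E (EFin \o z).
  by apply/measurable_EFinP; exact: measurable_funTS.
pose f_ := nnsfun_approx mE mf.
transitivity (limn (fun n => \int[nu]_(x in E) (f_ n x)%:E)).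
  rewrite -monotone_convergence//.
  - apply: eq_integral => y /[!inE] yD; apply/esym/cvg_lim => //.
    exact: cvg_nnsfun_approx.
  - by move=> n; exact/measurable_EFinP/measurable_funP.
  - by move=> n y _; rewrite lee_fin.
  - by move=> y _ m n mn; rewrite lee_fin; exact/lefP/nd_nnsfun_approx.
transitivity (limn (fun n => \int[mu]_(x in E) ((f_ n x)%:E * (z x)%:E))); last first.
  rewrite -monotone_convergence//.
  - apply: eq_integral => y /[!inE] yD; apply/cvg_lim => //.
    by apply: cvgeZr => //; exact: cvg_nnsfun_approx.
  - move=> n; apply: emeasurable_funM => //.
    exact/measurable_EFinP/measurable_funP.
  - by move=> n y _; rewrite mule_ge0// lee_fin.
  - move=> y _ m n mn; rewrite lee_wpmul2r ?lee_fin//.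
    exact/lefP/nd_nnsfun_approx.
congr (limn _); apply/funext => n.
have mk k : measurable (f_ n @^-1` [set k]) by exact: measurable_funPTI.
transitivity (\sum_(k \in range (f_ n))
    \int[nu]_(x in E) (k * \1_(f_ n @^-1` [set k]) x)%:E).
  under eq_integral do rewrite fimfunE -fsumEFin//.
  rewrite ge0_integral_fsum//.
  - by move=> y; exact/measurable_EFinP/measurable_funM.
  - by move=> y x _; rewrite nnfun_muleindic_ge0.
transitivity (\sum_(k \in range (f_ n))
    \int[mu]_(x in E) ((k * \1_(f_ n @^-1` [set k]) x)%:E * (z x)%:E)).
  apply: eq_fsbigr => k; rewrite inE => -[t _ ftk].
  have k0 : (0 <= k)%R by rewrite -ftk.
  rewrite integralZl_indic_nnsfun// integral_indic// nuE; last exact: measurableI.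
  under [RHS]eq_integral do rewrite EFinM -muleA.
  rewrite ge0_integralZl//; last 2 first.
  - apply: emeasurable_funM => //.
    exact/measurable_EFinP/measurable_indic.
  - by move=> x _; rewrite mule_ge0// lee_fin.
  congr (_ * _); rewrite setIC integral_mkcondr.
  by apply: eq_integral => x _; rewrite muleC epatch_indic.
under [RHS]eq_integral.
  move=> x _.
  rewrite [X in X * _](_ : _ = \sum_(k \in range (f_ n))
    (k * \1_(f_ n @^-1` [set k]) x)%:E); last by rewrite fimfunE -fsumEFin.
  rewrite ge0_mule_fsuml; last by move=> k; rewrite nnfun_muleindic_ge0.
  over.
rewrite ge0_integral_fsum//.
- move=> y; apply: emeasurable_funM => //.
  exact/measurable_EFinP/measurable_funM.
- by move=> y x _; rewrite mule_ge0 ?nnfun_muleindic_ge0 ?lee_fin.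
Qed.

Lemma integral_density (E : set T) (f : T -> \bar R) :
  measurable E -> measurable_fun E f ->
  \int[nu]_(t in E) f t = \int[mu]_(t in E) (f t * (z t)%:E).
Proof.
move=> mE mf; rewrite integralE [RHS]integralE !ge0_integral_density//.
- congr (_ - _); apply: eq_integral => t _.
  + by rewrite !funeposE maxe_pMl ?mul0e// lee_fin.
  + by rewrite !funenegE -mulNe maxe_pMl ?mul0e// lee_fin.
- exact: measurable_funeneg.
- exact: measurable_funepos.
Qed.
End density.

Section bounded_integrand.
Context d (T : measurableType d) (R : realType).
Variables (mu : {measure set T -> \bar R}) (E : set T).

Lemma integrable_bounded (f : T -> R) (M : R) :
  measurable E -> (mu E < +oo)%E -> measurable_fun E f ->
  (forall t, E t -> `|f t| <= M) -> mu.-integrable E (EFin \o f).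
Proof.
move=> mE Efin mf fM; apply: measurable_bounded_integrable => //.
by exists M; split => [|x Mx t Et]; [exact: num_real|exact: le_trans (fM t Et) (ltW Mx)].
Qed.

Lemma Rintegral_le_cst (f : T -> R) (K : R) :
  measurable E -> (mu E < +oo)%E -> mu.-integrable E (EFin \o f) ->
  (forall t, E t -> f t <= K) -> \int[mu]_(t in E) f t <= K * fine (mu E).
Proof.
move=> mE Efin intf fK; rewrite -(Rintegral_cst mu mE); apply: le_Rintegral => //.
exact: (@integrable_bounded _ `|K| mE Efin).
Qed.

End bounded_integrand.

Section ftc_leb.
Context (R : realType).
Implicit Types (a b : R) (f F : R -> R).

Lemma measurable_fun_itv_continuous a b f :
  (forall t, a <= t <= b -> {for t, continuous f}) ->
  measurable_fun (`[a, b]%classic : set (measurableTypeR R))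
    (f : measurableTypeR R -> R).
Proof.
move=> cf; apply: subspace_continuous_measurable_fun => //.
apply: continuous_in_subspaceT => t; rewrite inE/= in_itv/= => tab.
exact: cf.
Qed.

Lemma integral_leb_FTC a b f F : a <= b ->
  (forall t, a <= t <= b -> is_derive t 1 F (f t)) ->
  (forall t, a <= t <= b -> {for t, continuous f}) ->
  (\int[leb]_(t in (`[a, b]%classic : set (lebT R))) (f t)%:E = (F b - F a)%:E)%E.
Proof.
move=> ab dF cf.
rewrite integral_leb//; last first.
  by apply/measurable_EFinP; exact: measurable_fun_itv_continuous.
have [ba|{}ab] := leP b a.
  have -> : b = a by apply/le_anti; rewrite ba ab.
  by rewrite set_itv1 integral_set1 subrr.
have cF t : a <= t <= b -> {for t, continuous F}.
  move=> /dF [dt _]; apply: differentiable_continuous.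
  exact/derivable1_diffP.
rewrite (continuous_FTC2 (F := F))//.
- by apply: continuous_in_subspaceT => t; rewrite inE/= in_itv/= => /cf.
- split.
  + by move=> t; rewrite in_itv/= => /andP[/ltW ta /ltW tb]; apply: ex_derive; apply: dF;
    rewrite ta.
  + by apply: cvg_at_right_filter; apply: cF; rewrite lexx ltW.
  + by apply: cvg_at_left_filter; apply: cF; rewrite lexx ltW.
- move=> t; rewrite in_itv/= => /andP[/ltW ta /ltW tb].
  by rewrite derive1E; apply: derive_val; apply: dF; rewrite ta.
Qed.
End ftc_leb.

Section truncated.
Context (R : realType).

Lemma integral_onem_div (e b : R) : 0 < e -> e <= b ->
  (\int[leb]_(t in (`[e, b]%classic : set (lebT R))) (((1 - t) / t)%:E)
    = ((ln b - b) - (ln e - e))%:E)%E.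
Proof.
move=> e0 eb.
apply: (@integral_leb_FTC _ _ _ (fun t : R => (1 - t) / t) (fun t : R => ln t - t)) =>
  // t /andP[et tb].
- have t0 : 0 < t by exact: lt_le_trans et.
  rewrite mulrBl divff ?gt_eqF// mul1r.
  apply: is_deriveB.
  exact: is_derive1_ln.
- have t0 : 0 < t by exact: lt_le_trans et.
  apply: continuousM; first by apply: continuousB; [exact: cvg_cst|exact: cvg_id].
  by apply: continuousV; [rewrite gt_eqF|exact: cvg_id].
Qed.

End truncated.

(** * Masses of the truncated multipliers *)

Section truncated_masses.
Context (R : realType).
Implicit Types (n : nat) (e : R).

Lemma invn_itv n : (2 <= n)%N -> 0 < (n%:R^-1 : R) < 1.
Proof.
move=> n2; have n0 : (0 : R) < n%:R by rewrite ltr0n (leq_trans _ n2).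
by rewrite invr_gt0 n0/= invf_lt1// ltr1n.
Qed.

Lemma a_E n : (2 <= n)%N -> a_ R n = ln n%:R - 1 + n%:R^-1.
Proof.
move=> n2; have /andP[n0 n1] := invn_itv n2.
rewrite /a_ /Rintegral integral_onem_div//=; last exact: ltW.
rewrite ln1 lnV ?posrE; last by rewrite -invr_gt0.
by lra.
Qed.

Lemma lambda0_E n : (2 <= n)%N -> lambda0_ R n = (ln n%:R + n%:R^-1)^-1.
Proof. by move=> n2; rewrite /lambda0_ a_E// addrA addrCA subrr addr0. Qed.

Lemma lambda0_gt0 n : (2 <= n)%N -> 0 < lambda0_ R n.
Proof.
move=> n2; rewrite lambda0_E// invr_gt0 addr_gt0//.
  by rewrite ln_gt0// ltr1n.
by have /andP[] := invn_itv n2.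
Qed.

(** This is the normalization of the multipliers: [a_ n] is the mass of (1 - t) / t, so the left
    side is the total mass of [z_ n]. *)
Lemma lambda0_a n : (2 <= n)%N -> lambda0_ R n * a_ R n = 1 - lambda0_ R n.
Proof.
move=> n2; have := lambda0_gt0 n2; rewrite /lambda0_ invr_gt0 => a0.
by field; rewrite gt_eqF.
Qed.

Lemma measurable_leb_itv (i : interval R) : measurable ([set` i] : set (lebT R)).
Proof. by apply: measurable_leb; exact: measurable_itv. Qed.

Lemma measurable_onem_div : measurable_fun [set: measurableTypeR R]
  ((fun t => (1 - t) / t) : measurableTypeR R -> R).
Proof.
apply: measurable_funM; first exact: measurable_funB.
exact: measurable_invr.
Qed.

Lemma mu_leb01E n (E : set (lebT R)) : measurable E ->
  mu_ R n E = (\int[leb]_(t in E `&` (`[0%R, 1%R]%classic : set R)) (z_ R n t)%:E)%E.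
Proof.
move=> mE; rewrite /mu_ integral_lebI//; apply: measurable_funTS.
exact/measurable_EFinP/measurable_z_.
Qed.

Lemma mu_restr n (E : set (lebT R)) : measurable E ->
  mu_ R n E = (\int[leb]_(t in E `&` (`[n%:R^-1%R, 1%R]%classic : set R))
    (lambda0_ R n * ((1 - t) / t))%:E)%E.
Proof.
move=> mE; rewrite mu_leb01E//.
rewrite integral_mkcondr [RHS]integral_mkcondr; apply: eq_integral => t tE.
rewrite /patch !mem_setE !in_itv/= /z_.
have [/andP[nt t1]|//] := boolP (n%:R^-1 <= t <= 1); last by rewrite if_same.
by rewrite t1 (le_trans _ nt)// invr_ge0.
Qed.

Lemma mu_itv n (e : R) : (2 <= n)%N -> n%:R^-1 <= e <= 1 ->
  mu_ R n (`[e, 1%R]%classic : set R) = (lambda0_ R n * (e - 1 - ln e))%:E.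
Proof.
move=> n2 /andP[ne e1].
have /andP[n0 _] := invn_itv n2; have e0 := lt_le_trans n0 ne.
rewrite mu_restr; last exact: measurable_leb_itv.
rewrite setIidl; last first.
  by move=> t/=; rewrite !in_itv/= => /andP[et ->]; rewrite (le_trans ne).
under eq_integral do rewrite EFinM.
rewrite (ge0_integralZl_EFin _ (measurable_leb_itv _)).
- by rewrite integral_onem_div// ln1 -EFinM; congr (_ * _)%:E; lra.
- move=> t/=; rewrite in_itv/= => /andP[et t1].
  by rewrite lee_fin divr_ge0// ?subr_ge0// (le_trans _ et)// ltW.
- apply: measurable_funTS; apply/measurable_EFinP.
  exact: (measurable_fun_leb measurableT measurable_onem_div).
- by rewrite ltW// lambda0_gt0.
Qed.

End truncated_masses.

Section asymptotics.
Context (R : realType).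
Implicit Types (n : nat) (e : R).

Lemma ln_natr_cvgy : (ln n%:R : R) @[n --> \oo] --> +oo.
Proof.
apply/cvgryPge => A; near=> n.
have n_ge : expR A <= n%:R by near: n; apply: nbhs_infty_ger.
rewrite -(expRK A) ler_ln ?posrE ?expR_gt0//.
exact: lt_le_trans (expR_gt0 A) n_ge.
Unshelve. all: by end_near. Qed.

Lemma invr_natr_cvg0 : (n%:R^-1 : R) @[n --> \oo] --> (0 : R).
Proof.
apply/gtr0_cvgV0; first by near=> n; rewrite ltr0n; near: n; exact: nbhs_infty_gt.
exact: cvgr_idn.
Unshelve. all: by end_near. Qed.

Lemma lambda0_cvg0 : lambda0_ R @ \oo --> (0 : R).
Proof.
have : ((ln n%:R)^-1 : R) @[n --> \oo] --> (0 : R).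
  apply/gtr0_cvgV0; last exact: ln_natr_cvgy.
  near=> n; rewrite ln_gt0// ltr1n; near: n; exact: nbhs_infty_gt.
apply: squeeze_cvgr (@cvg_cst _ _ _ _ _); near=> n.
have n2 : (2 <= n)%N by near: n; exact: nbhs_infty_ge.
have ln0 : 0 < ln (n%:R : R) by rewrite ln_gt0// ltr1n.
have /andP[nV _] := invn_itv R n2.
rewrite (ltW (lambda0_gt0 R n2)) lambda0_E//= lef_pV2 ?posrE// ?addr_gt0//.
by rewrite lerDl ltW.
Unshelve. all: by end_near. Qed.

Lemma mu_total n (E : set (lebT R)) : (2 <= n)%N -> measurable E ->
  (`[n%:R^-1, 1]%classic : set R) `<=` E ->
  mu_ R n E = (1 - lambda0_ R n)%:E.
Proof.
move=> n2 mE nE; have /andP[n0 n1] := invn_itv R n2.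
transitivity (mu_ R n (`[n%:R^-1, 1]%classic : set R)).
  rewrite !mu_restr//; last exact: measurable_leb_itv.
  by rewrite setIid setIidr.
rewrite mu_itv//; last by rewrite lexx ltW.
rewrite -lambda0_a// a_E//; congr (_ * _)%:E.
by rewrite lnV ?posrE -1?invr_gt0//; lra.
Qed.

(** For 1/n <= e the mass is exactly lambda0 (e - 1 - ln e), and e <= 1. For e <= 1/n the interval
    holds the whole mass lambda0 a_n, where a_n <= ln n <= ln (1/e). *)
Lemma mu_tail_le n e : (2 <= n)%N -> 0 < e < 1 ->
  (mu_ R n (`[e, 1%R]%classic : set R) <= (lambda0_ R n * ln (1 / e))%:E)%E.
Proof.
move=> n2 /andP[e0 e1]; have /andP[n0 n1] := invn_itv R n2.
rewrite div1r lnV ?posrE//.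
have [ne|/ltW en] := leP n%:R^-1 e.
  rewrite mu_itv//; last by rewrite ne ltW.
  by rewrite lee_fin ler_wpM2l ?(ltW (lambda0_gt0 R n2))//; lra.
rewrite mu_total//; last 2 first.
- exact: measurable_leb_itv.
- by move=> t /=; rewrite !in_itv/= => /andP[nt ->]; rewrite (le_trans en).
rewrite -lambda0_a// lee_fin ler_wpM2l ?(ltW (lambda0_gt0 R n2))//.
rewrite a_E//.
have : ln e <= ln n%:R^-1 by rewrite ler_ln ?posrE.
rewrite lnV ?posrE -1?invr_gt0//; lra.
Qed.

Lemma mu_lebI n (E : set (lebT R)) : measurable E ->
  (\int[lebI (n%:R^-1) 1]_(t in E) (z_ R n t)%:E)%E = mu_ R n E.
Proof.
move=> mE; rewrite (mu_restr _ mE).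
rewrite (integral_lebI _ _ mE); last first.
  by apply: measurable_funTS; exact/measurable_EFinP/measurable_z_.
by apply: eq_integral => t; rewrite inE/= => -[_]; rewrite in_itv/= /z_ => ->.
Qed.

Lemma Lnorm1_z n : (2 <= n)%N ->
  ('N[leb01 R]_1[EFin \o z_ R n] = (1 - lambda0_ R n)%:E)%E.
Proof.
move=> n2; rewrite Lnorm1.
under eq_integral do rewrite /= ger0_norm ?z__ge0//.
by rewrite -(@mu_total _ setT).
Qed.

Lemma Lnorm1_z_lebI n : (2 <= n)%N ->
  ('N[lebI (n%:R^-1) 1]_1[EFin \o z_ R n] = (1 - lambda0_ R n)%:E)%E.
Proof.
move=> n2; rewrite Lnorm1.
under eq_integral do rewrite /= ger0_norm ?z__ge0//.
by rewrite mu_lebI// (mu_total n2).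
Qed.

End asymptotics.

(** * Norms of the multipliers *)

Section lebI_ae.
Context (R : realType).
Implicit Types (a b c d : R).

Lemma lebI_itv a b c d : a <= c -> c <= d -> d <= b ->
  lebI a b (`[c, d]%classic : set R) = (d - c)%:E.
Proof.
move=> ac cd db; rewrite lebIE setIidl; last first.
  by move=> t /=; rewrite !in_itv/= => /andP[ct td]; rewrite (le_trans ac)// (le_trans td).
rewrite -[LHS]/(lebesgue_measure (`[c, d]%classic : set R)) lebesgue_measure_itv/= lte_fin.
case: ltP => // dc; congr EFin.
by apply/esym/eqP; rewrite subr_eq0 eq_le cd dc.
Qed.

Lemma lebI_setT_gt0 a b : a < b -> (0 < lebI a b setT)%E.
Proof.
move=> ab; rewrite lebIE setTI.
rewrite -[X in (_ < X)%E]/(lebesgue_measure (`[a, b]%classic : set R)).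
by rewrite lebesgue_measure_itv/= lte_fin ab -EFinD lte_fin subr_gt0.
Qed.

(** A nondegenerate subinterval has positive measure and cannot lie in the exceptional null set.
    This provides actual points at which an essential bound can be read off. *)
Lemma ae_lebI_exists a b c d (P : R -> Prop) : a <= c -> c < d -> d <= b ->
  (\forall t \ae lebI a b, P t) -> exists2 t, c <= t <= d & P t.
Proof.
move=> ac cd db [N [mN N0 PN]]; apply: contrapT => /forall2NP noP.
have cdN : (`[c, d]%classic : set R) `<=` N.
  by move=> t /=; rewrite in_itv/= => tcd; apply: PN; case: (noP t).
have : (lebI a b (`[c, d]%classic : set R) <= lebI a b N)%E.
  by apply: le_measure => //; rewrite inE//; exact: measurable_leb_itv.
rewrite [X in (_ <= X)%E]N0 lebI_itv//; last exact: ltW.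
by rewrite lee_fin subr_le0 leNgt cd.
Qed.

Lemma ae_lebIP a b (P : R -> Prop) :
  (\forall t \ae leb, a <= (t : R) <= b -> P t) -> \forall t \ae lebI a b, P t.
Proof.
move=> [N [mN N0 PN]]; exists (N `|` ~` (`[a, b]%classic : set R)); split.
- by apply: measurableU => //; apply: measurableC; exact: measurable_leb_itv.
- rewrite lebIE setIUl setICl setU0; apply: (subset_measure0 _ mN) => //.
  by apply: measurableI => //; exact: measurable_leb_itv.
- move=> t /= nP; have [tab|tab] := pselect (a <= t <= b).
    by left; apply: PN => /= /(_ tab).
  by right => /=; rewrite in_itv.
Qed.

Lemma nearW_lebI a b (P : R -> Prop) :
  (forall t, a <= t <= b -> P t) -> \forall t \ae lebI a b, P t.
Proof. by move=> h; apply: ae_lebIP; apply: nearW. Qed.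

Lemma Lnorm_infty_lebI_le a b (f : lebT R -> R) (M : R) : 0 <= M ->
  (\forall t \ae lebI a b, `|f t| <= M) ->
  ('N[lebI a b]_+oo[EFin \o f] <= M%:E)%E.
Proof.
move=> M0 fM; rewrite unlock; case: ifPn => // _.
by apply/ess_supP; apply: filterS fM => t /=; rewrite lee_fin.
Qed.

Lemma Lnorm_infty_ae (a b : R) (f : lebT R -> R) (M : R) : a < b ->
  ('N[lebI a b]_+oo[EFin \o f] <= M%:E)%E ->
  \forall t \ae lebI a b, `|f t| <= M.
Proof.
move=> ab; rewrite unlock lebI_setT_gt0// => /ess_supP.
by apply: filterS => t /=; rewrite lee_fin.
Qed.

Lemma Lnorm_infty_lambda n : (2 <= n)%N ->
  ('N[leb01 R]_+oo[EFin \o lambda_ R n]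
           = (lambda0_ R n * (1 - n%:R^-1))%:E)%E.
Proof.
move=> n2; have /andP[n0 n1] := invn_itv R n2; have l0 := lambda0_gt0 R n2.
have le : ('N[leb01 R]_+oo[EFin \o lambda_ R n]
           <= (lambda0_ R n * (1 - n%:R^-1))%:E)%E.
  apply: Lnorm_infty_lebI_le; first by rewrite mulr_ge0// ?ltW// subr_gt0.
  apply: nearW_lebI => t _; rewrite /lambda_.
  case: ifPn => [/andP[nt t1]|_]; last first.
    by rewrite normr0 mulr_ge0// ?ltW// subr_gt0.
  rewrite normrM gtr0_norm// ler_pM2l// distrC ger0_norm ?subr_ge0//.
  by rewrite lerD2l lerN2.
apply/le_anti; rewrite le/=.
have nfin : ('N[leb01 R]_+oo[EFin \o lambda_ R n])%E \is a fin_num.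
  by rewrite ge0_fin_numE ?Lnorm_ge0// (le_lt_trans le)// ltry.
rewrite -(fineK nfin) lee_fin.
set y := fine _; have fy : \forall t \ae leb01 R, `|lambda_ R n t| <= y.
  by apply: Lnorm_infty_ae => //; rewrite /y fineK.
apply/ler_addgt0Pr => d d0.
(* The supremum is approached to the right of 1/n: for 1/n <= t <= d' the value |lambda_n(t)| is
   within [d] of the claimed norm. The cap 1 keeps d' in the range where [lambda_] is not cut
   off. *)
set d' := Num.min (n%:R^-1 + d / lambda0_ R n) 1.
have nd : n%:R^-1 < d' by rewrite lt_min n1 ltrDl divr_gt0.
have d'1 : d' <= 1 by rewrite ge_min lexx orbT.
have [t /andP[nt]] := ae_lebI_exists (ltW n0) nd d'1 fy.
rewrite le_min => /andP[td t1]; rewrite /lambda_ nt t1/=.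
rewrite normrM gtr0_norm// distrC ger0_norm ?subr_ge0// => ty.
have : lambda0_ R n * t <= lambda0_ R n * n%:R^-1 + d.
  by rewrite -ler_pdivlMl// mulrDr mulKf ?gt_eqF// mulrC.
lra.
Qed.

Lemma Lnorm_infty_lambda_cvg0 :
  (fun n => 'N[leb01 R]_+oo[EFin \o lambda_ R n])%E @ \oo --> 0%E.
Proof.
have : (lambda0_ R n * (1 - n%:R^-1))%:E @[n --> \oo] --> (0 * (1 - 0))%:E.
  apply: cvg_EFin; first exact: nearW.
  apply: cvgM; first exact: lambda0_cvg0.
  by apply: cvgB; [exact: cvg_cst|exact: invr_natr_cvg0].
rewrite mul0r; apply: cvg_trans; apply: near_eq_cvg.
near=> n; rewrite Lnorm_infty_lambda//; near: n; exact: nbhs_infty_ge.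
Unshelve. all: by end_near. Qed.

Lemma Lnorm1_z_cvg1 : (fun n => 'N[leb01 R]_1[EFin \o z_ R n])%E @ \oo --> 1%E.
Proof.
have : (1 - lambda0_ R n)%:E @[n --> \oo] --> (1 - 0)%:E.
  apply: cvg_EFin; first exact: nearW.
  by apply: cvgB; [exact: cvg_cst|exact: lambda0_cvg0].
rewrite subr0; apply: cvg_trans; apply: near_eq_cvg.
near=> n; rewrite Lnorm1_z//; near: n; exact: nbhs_infty_ge.
Unshelve. all: by end_near. Qed.

Lemma lambda0_mulr_cvg0 (c : R) : (fun n => lambda0_ R n * c) @ \oo --> (0 : R).
Proof.
rewrite -[X in _ --> X](mul0r c); apply: cvgMl.
exact: lambda0_cvg0.
Qed.

Lemma mu_tail_cvg0 (e : R) : 0 < e < 1 ->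
  (fun n => mu_ R n (`[e, 1]%classic : set R)) @ \oo --> 0%E.
Proof.
move=> e01.
have h : (fun n => (lambda0_ R n * ln (1 / e))%:E) @ \oo --> 0%E.
  by apply: cvg_EFin; [exact: nearW|exact: lambda0_mulr_cvg0].
apply: squeeze_cvge (cvg_cst _) h; near=> n.
rewrite measure_ge0 mu_tail_le//.
near: n; exact: nbhs_infty_ge.
Unshelve. all: by end_near. Qed.

Lemma Lfun1_z n : (2 <= n)%N -> z_ R n \in Lfun (leb01 R) 1%E.
Proof.
move=> n2; rewrite inE/=; apply/andP; split; rewrite inE/=.
  exact: measurable_z_.
by rewrite /finite_norm Lnorm1_z// ltry.
Qed.

End lebI_ae.

(** * Weak convergence in L1 and the weak* limit on continuous functions *)

Section weak_L1.
Context (R : realType).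

Lemma integrable_L1 (E : set (lebT R)) (g : L1 R) : measurable E ->
  (leb01 R).-integrable E (EFin \o g).
Proof.
move=> mE; apply: (@integrableS _ _ _ _ setT) => //.
by apply/Lfun1_integrable; exact: LfunP.
Qed.

(** The bound 1 comes from comparing the integral of g over E with the L1 norm. These are the test
    functionals that refute weak convergence in L1. *)
Lemma Lfun_dual_Rintegral (E : set (lebT R)) : measurable E ->
  Lfun_dual (fun g : L1 R => \int[leb01 R]_(t in E) g t).
Proof.
move=> mE; split.
  move=> a u v.
  rewrite -RintegralZl//; last exact: integrable_L1.
  rewrite -RintegralD//; last exact: integrable_L1.
  exact: (@integrable_L1 _ (a *: u)).
exists 1 => f; rewrite mul1e Lnorm1.
have fE := integrable_L1 f mE.
rewrite EFin_normr_Rintegral//.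
apply: (le_trans (le_abse_integral _ mE (measurable_int _ fE))).
have mf := measurable_int _ (integrable_L1 f measurableT).
have mabs := measurableT_comp (@abse_measurable R setT) mf.
by have /= := ge0_subset_integral (leb01 R) mE measurableT mabs; apply.
Qed.

Lemma z_not_weakly_cvg (phi : nat -> nat) : {homo phi : i j / (i < j)%N} ->
  (forall k, (2 <= phi k)%N) ->
  ~ exists f : R -> R, weak_cvg_L1 (fun k => z_ R (phi k)) f.
Proof.
move=> phi_incr phi2 [f [U [F [UE _ weak]]]].
have phi_ge k : (k <= phi k)%N.
  by elim: k => // k IHk; rewrite (leq_ltn_trans IHk)// phi_incr.
have phiy : phi @ \oo --> \oo.
  apply/cvgnyPge => A; near=> k; rewrite (leq_trans _ (phi_ge k))//.
  near: k; exact: nbhs_infty_ge.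
have muU (E : set (lebT R)) : measurable E ->
    (fun k => fine (mu_ R (phi k) E)) @ \oo --> \int[leb01 R]_(t in E) F t.
  move=> mE; have := weak _ (Lfun_dual_Rintegral mE).
  by under eq_fun do rewrite UE.
have F1 : \int[leb01 R]_(t in setT) F t = 1.
  have h := muU setT measurableT.
  apply: (cvg_unique (@Rhausdorff R) h) => /=.
  have -> : (fun k => fine (mu_ R (phi k) setT)) = (fun k => 1 - lambda0_ R (phi k)).
    by apply/funext => k; rewrite (@mu_total _ _ setT).
  rewrite -[X in _ --> X]subr0; apply: cvgB; first exact: cvg_cst.
  have lphi := @cvg_comp _ _ _ phi (lambda0_ R) _ _ _ phiy (@lambda0_cvg0 R).
  exact: lphi.
have F0 d : 0 < d < 1 -> \int[leb01 R]_(t in (`[d, 1]%classic : set R)) F t = 0.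
  move=> d01; have h := muU _ (@measurable_leb_itv R `[d, 1]).
  apply: (cvg_unique (@Rhausdorff R) h) => /=.
  have : (fun k => mu_ R (phi k) (`[d, 1]%classic : set R)) @ \oo --> 0%E.
    have mphi := @cvg_comp _ _ _ phi (fun n => mu_ R n _) _ _ _ phiy (mu_tail_cvg0 d01).
    exact: mphi.
  by move=> /fine_cvg.
(* Absolute continuity of the integral at level 1: a set of measure below [d] carries less than 1 of
   |F|, whereas the integral 1 of F comes entirely from the complement of each [e, 1]. *)
have [d [d0 small]] := integral_normr_continuous (integrable_L1 F measurableT) (@ltr01 R).
set e := Num.min (d / 2) (1 / 2).
have [e0 e1] : 0 < e /\ e < 1.
  by rewrite lt_min gt_min divr_gt0//=; split; [lra|apply/orP; right; lra].
have ed : e < d by rewrite gt_min; apply/orP; left; lra.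
have mD := @measurable_leb_itv R `[e, 1].
have mA := measurableC mD; set A := ~` _ in mA.
have muA : (leb01 R A <= leb01 R (`[0%R, e]%classic : set R))%E.
  rewrite !lebIE; apply: le_measure; rewrite ?inE.
  - by apply: measurableI => //; exact: measurable_leb_itv.
  - by apply: measurableI; exact: measurable_leb_itv.
  - move=> t [/=]; rewrite !in_itv/= => /negP + /andP[t0 t1].
    by rewrite in_itv/= t0 t1 andbT -ltNge => /ltW ->.
have {}muA : (leb01 R A < d%:E)%E.
  by apply: (le_lt_trans muA); rewrite lebI_itv// ?ltW// subr0 lte_fin.
have := small A mA muA; apply/negP; rewrite -leNgt -[X in X <= _]F1.
have -> : \int[leb01 R]_(t in setT) F t = \int[leb01 R]_(t in A) F t.
  rewrite -[RHS]add0r -[X in _ = X + _](F0 e) ?e0//.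
  rewrite -[X in \int[_]_(_ in X) _](setUv (`[e, 1]%classic : set R)).
  apply: Rintegral_setU => //.
  - by rewrite setUv; exact: integrable_L1.
  - by apply/disj_setPCl.
apply: (le_trans (ler_norm _)).
by apply: le_normr_Rintegral => //; exact: integrable_L1.
Unshelve. all: by end_near. Qed.
End weak_L1.

Section dirac_limit.
Context (R : realType).

Lemma measurable01 : measurable ((`[0%R, 1%R]%classic : set R) : set (lebT R)).
Proof. exact: measurable_leb_itv. Qed.

Lemma mu01 n : (2 <= n)%N -> mu_ R n (`[0%R, 1%R]%classic : set R) = (1 - lambda0_ R n)%:E.
Proof.
move=> n2; have /andP[n0 n1] := invn_itv R n2; apply: mu_total => //.
  exact: measurable01.
by move=> t /=; rewrite !in_itv/= => /andP[nt ->]; rewrite (le_trans (ltW n0)).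
Qed.

Lemma mu_le1 n (E : set (lebT R)) : (2 <= n)%N -> measurable E ->
  (mu_ R n E <= 1%:E)%E.
Proof.
move=> n2 mE; apply: (@le_trans _ _ (mu_ R n setT)).
  by apply: le_measure => //; rewrite inE.
by rewrite mu_total// lee_fin gerBl ltW// lambda0_gt0.
Qed.

(** [mu_ n] has mass 1 - lambda0, so the constant c loses lambda0 |c|. On [0, d[ the mass is at most
    1 and f is [e]-close to c; on [d, 1] the deviation K meets a mass of at most lambda0 ln
    (1/d). *)
Lemma Rintegral_mu_dist n (f : lebT R -> R) (c e K d : R) : (2 <= n)%N ->
  measurable_fun ((`[0,
    1]%classic : set R) : set (lebT R)) f -> 0 < d < 1 -> 0 <= e -> 0 <= K ->
  (forall t, 0 <= t <= 1 -> `|f t - c| <= K) ->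
  (forall t, 0 <= t < d -> `|f t - c| <= e) ->
  `|\int[mu_ R n]_(t in (`[0, 1]%classic : set R)) f t - c|
    <= e + lambda0_ R n * (K * ln (1 / d) + `|c|).
Proof.
move=> n2 mf d01 e0 K0 fK fe; have [d0 d1] := andP d01.
have mlt E : measurable E -> (mu_ R n E < +oo)%E.
  by move=> mE; apply: (le_lt_trans (mu_le1 n2 mE)); rewrite ltry.
have l0 := lambda0_gt0 R n2.
have mg : measurable_fun ((`[0, 1]%classic : set R) : set (lebT R)) (fun t => f t - c).
  by apply: measurable_funB => //; exact: measurable_cst.
have intg : (mu_ R n).-integrable ((`[0,
  1]%classic : set R) : set (lebT R)) (EFin \o (fun t => f t - c)).
  apply: (@integrable_bounded _ _ _ _ _ _ K measurable01 (mlt _ measurable01) mg).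
  by move=> t /=; rewrite in_itv/=; exact: fK.
have intc : (mu_ R n).-integrable ((`[0,
  1]%classic : set R) : set (lebT R)) (EFin \o (fun t => c)).
  apply: (@integrable_bounded _ _ _ _ _ _ `|c| measurable01 (mlt _ measurable01)) => //.
have -> : \int[mu_ R n]_(t in (`[0, 1]%classic : set R)) f t - c =
    \int[mu_ R n]_(t in (`[0, 1]%classic : set R)) (f t - c) - c * lambda0_ R n.
  transitivity (\int[mu_ R n]_(t in (`[0, 1]%classic : set R)) ((f t - c) + c) - c).
    by congr (_ - _); apply: eq_Rintegral => t _; rewrite subrK.
  rewrite (RintegralD measurable01 intg intc) (Rintegral_cst _ measurable01).
  rewrite [X in fine X](mu01 n2)/=; ring.
apply: (le_trans (ler_normB _ _)).
rewrite [X in _ + X <= _]normrM (gtr0_norm l0) mulrDr addrA [X in _ <= _ + X]mulrC lerD2r.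
apply: (le_trans (le_normr_Rintegral measurable01 intg)).
have E01 : (`[0, 1]%classic : set R) = (`[0, d[%classic : set R) `|` (`[d,
  1]%classic : set R).
  apply/seteqP; split => t /=; rewrite !in_itv/=.
    by move=> /andP[-> ->]; rewrite andbT/=; case: (ltP t d) => _; [left|right].
  by move=> [/andP[-> /ltW td]|/andP[dt ->]];
    rewrite ?(le_trans td) ?ltW// ?(lt_le_trans d0).
have intn := integrable_norm intg.
rewrite [X in \int[_]_(_ in X) _ <= _]E01 Rintegral_setU//; last 4 first.
- exact: measurable_leb_itv.
- exact: measurable_leb_itv.
- by rewrite -E01.
- by apply/disj_setPS => t []/=;
  rewrite !in_itv/= => /andP[_ td] /andP[/le_lt_trans/(_ td)]; rewrite ltxx.
have m0 : measurable ((`[0, d[%classic : set R) : set (lebT R))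
  by exact: measurable_leb_itv.
have m1 : measurable ((`[d, 1]%classic : set R) : set (lebT R))
  by exact: measurable_leb_itv.
apply: lerD.
- apply: (@le_trans _ _ (e * fine (mu_ R n (`[0%R, d[%classic : set R)))).
    apply: (Rintegral_le_cst m0 (mlt _ m0)).
      by apply: integrableS intn => //; [exact: measurable01|rewrite E01; exact: subsetUl].
    by move=> t /=; rewrite in_itv/=; exact: fe.
  rewrite ler_piMr// -lee_fin fineK ?mu_le1//.
  by rewrite ge0_fin_numE ?measure_ge0// mlt.
- rewrite mulrCA; apply: (@le_trans _ _ (K * fine (mu_ R n (`[d%R, 1%R]%classic : set R)))).
    apply: (Rintegral_le_cst m1 (mlt _ m1)).
      by apply: integrableS intn => //; [exact: measurable01|rewrite E01; exact: subsetUr].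
    by move=> t /=; rewrite in_itv/= => /andP[dt t1]; apply: fK;
      rewrite t1 (le_trans (ltW d0)).
  rewrite ler_wpM2l// -lee_fin fineK ?mu_tail_le//.
  by rewrite ge0_fin_numE ?measure_ge0// mlt.
Qed.

Lemma mu_weakstar_dirac (phi : R -> R) : {within `[0, 1]%classic, continuous phi} ->
  (fun n => \int[mu_ R n]_(t in (`[0, 1]%classic : set R)) phi t) @ \oo -->
  \int[\d_((0 : R) : lebT R)]_(t in (`[0, 1]%classic : set R)) phi t.
Proof.
move=> cphi.
have mphi : measurable_fun ((`[0, 1]%classic : set R) : set (lebT R)) (phi : lebT R -> R).
  apply: measurable_fun_leb; first exact: measurable_itv.
  exact: subspace_continuous_measurable_fun.
rewrite [X in _ --> X](_ : _ = phi 0); last first.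
  rewrite /Rintegral integral_dirac; last 2 first.
  - exact: measurable01.
  - exact/measurable_EFinP.
  by rewrite diracE mem_set ?mul1e//= in_itv/= lexx ler01.
(* The difference of the maximum and the minimum serves as the global deviation K. *)
have [x1 x1I phimax] := EVT_max ler01 cphi.
have [x2 x2I phimin] := EVT_min ler01 cphi.
have /continuous_within_itvP := cphi => /(_ ltr01)[_ phi0 _].
apply/cvgrPdist_le => e e0.
have e20 : 0 < e / 2 by rewrite divr_gt0.
have /cvgrPdist_le/(_ _ e20) [d0 /= d0_gt0 phid] := phi0.
set d := Num.min d0 (1 / 2).
have d01 : 0 < d < 1.
  by rewrite lt_min gt_min d0_gt0/=; apply/andP; split; [lra|apply/orP; right; lra].
set C := (phi x1 - phi x2) * ln (1 / d) + `|phi 0|.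
have := lambda0_mulr_cvg0 C => /cvgrPdist_le /(_ _ e20) lC.
near=> n; rewrite distrC.
have n2 : (2 <= n)%N by near: n; exact: nbhs_infty_ge.
apply: (le_trans (@Rintegral_mu_dist n phi (phi 0) (e / 2) (phi x1 - phi x2) d _ _ _ _ _
  _ _)) => //.
- exact: ltW.
- by rewrite subr_ge0 phimin.
- move=> t t01; have tI : t \in `[0, 1] by rewrite in_itv.
  have := phimax _ tI; have := phimin _ tI.
  have oI : (0 : R) \in `[0, 1] by rewrite in_itv/= lexx ler01.
  have := phimax _ oI; have := phimin _ oI.
  by move=> h1 h2 h3 h4; rewrite ler_norml; apply/andP; split; lra.
(* [phi0] is a limit from the right, so the point t = 0 is settled apart. *)
- move=> t /andP[]; rewrite le_eqVlt => /predU1P[<- _|t0 td].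
    by rewrite subrr normr0 ltW.
  rewrite distrC; apply: phid => //=; rewrite sub0r normrN gtr0_norm//.
  by rewrite (lt_le_trans td)// ge_min lexx.
- rewrite [leRHS]splitr lerD2l -/C.
  suff : `|0 - lambda0_ R n * C| <= e / 2 by rewrite sub0r normrN; apply: le_trans;
    exact: ler_norm.
  by near: n.
Unshelve. all: by end_near. Qed.

Lemma dirac_not_dominated : ~ (\d_((0 : R) : lebT R) `<< leb01 R).
Proof.
move=> dom; have : (leb01 R).-null_set [set (0 : R)].
  move=> A mA A0; apply/eqP; rewrite eq_le measure_ge0 andbT.
  apply: (@le_trans _ _ (leb01 R (`[0%R, 0%R]%classic : set R))).
    apply: le_measure; rewrite ?inE//; first exact: measurable_leb_itv.
    by move=> t /A0 ->; rewrite /= in_itv/= lexx.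
  by rewrite lebI_itv// subrr.
move=> /dom /(_ (`[0, 0]%classic : set R) (@measurable_leb_itv R `[0, 0])).
rewrite diracE mem_set/=; last by rewrite in_itv/= lexx.
move=> h; suff /h /eqP : (`[0, 0]%classic : set R) `<=` [set (0 : R)].
  by rewrite eqe oner_eq0.
by move=> t /=; rewrite in_itv/= => /andP[t0 t1]; apply/le_anti; rewrite t0 t1.
Qed.
End dirac_limit.

(** * Oscillation of the weak* limit on essentially bounded functions *)

Section oscillation.
Context (R : realType).

(** This is sqrt 2 / 2 times the sine of v - pi / 4, whence its range. *)
Definition osc (v : R) : R := (sin v - cos v) / 2.

(** Rests on osc + osc' = sin: with v = 1 - ln t, the derivative of v osc (ln v) in v is sin (ln v),
    and dv/dt = - 1/t. For t <= 1 one has v >= 1, so the outer logarithm is differentiable. *)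
Lemma is_derive_osc_ln (t : R) : 0 < t <= 1 ->
  is_derive t 1 (fun t : R => - ((1 - ln t) * osc (ln (1 - ln t))))
    (sin (ln (1 - ln t)) / t).
Proof.
move=> /andP[t0 t1].
have v1 : 1 <= 1 - ln t by rewrite lerBrDr gerDl ln_le0.
have v0 : 0 < 1 - ln t by exact: lt_le_trans v1.
have dv : is_derive t 1 (fun t : R => 1 - ln t) (- t^-1).
  rewrite -[X in is_derive _ _ _ X]add0r; apply: is_deriveB.
  exact: is_derive1_ln.
have dl : is_derive t 1 (fun t : R => ln (1 - ln t)) ((1 - ln t)^-1 * (- t^-1)).
  by apply: (@is_derive1_comp _ (@ln R) (fun t => 1 - ln t)); exact: is_derive1_ln.
have ds : is_derive t 1 (fun t : R =>
  sin (ln (1 - ln t))) (cos (ln (1 - ln t)) * ((1 - ln t)^-1 * (- t^-1))).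
  exact: (@is_derive1_comp _ (@sin R) (fun t => ln (1 - ln t))).
have dc : is_derive t 1 (fun t : R =>
  cos (ln (1 - ln t))) (- sin (ln (1 - ln t)) * ((1 - ln t)^-1 * (- t^-1))).
  exact: (@is_derive1_comp _ (@cos R) (fun t => ln (1 - ln t))).
have dd := is_deriveM (is_deriveB ds dc) (is_derive_cst (2^-1 : R) t 1).
rewrite /osc; apply: (is_derive_eq (is_deriveN (is_deriveM dv dd))).
rewrite scaler0 add0r /GRing.scale/= !fctE; field.
by rewrite !gt_eqF.
Qed.

Lemma osc_le1 (v : R) : `|osc v| <= 1.
Proof.
have := sin_le1 v; have := sin_geN1 v; have := cos_le1 v; have := cos_geN1 v.
by move=> *; rewrite /osc ler_norml; apply/andP; split; lra.
Qed.

Lemma continuous_osc : continuous osc.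
Proof.
move=> v; apply: cvgMl; apply: cvgB; [exact: continuous_sin|exact: continuous_cos].
Qed.

Lemma oscD2pin (v : R) (k : nat) : osc (v + pi *+ 2 *+ k) = osc v.
Proof. by rewrite /osc (periodicn (@sinD2pi R)) (periodicn (@cosD2pi R)). Qed.

Lemma osc_onto (c : R) : - (Num.sqrt 2 / 2) <= c <= Num.sqrt 2 / 2 ->
  exists v, osc v = c.
Proof.
move=> cI; have c2 : c ^+ 2 <= 1 / 2.
  rewrite -ler_norml in cI; rewrite -real_normK ?num_real//.
  apply: (@le_trans _ _ ((Num.sqrt 2 / 2) ^+ 2)); first by rewrite lerXn2r ?nnegrE.
  by rewrite exprMn sqr_sqrtr//; lra.
(* The sine and cosine of the wanted angle are to be c + w and w - c: they differ by 2c, and this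
   [w] makes their squares add up to 1. *)
pose w := Num.sqrt (1 / 2 - c ^+ 2).
have w2 : w ^+ 2 = 1 / 2 - c ^+ 2 by rewrite sqr_sqrtr// subr_ge0.
have sk1 : (c + w) ^+ 2 + (w - c) ^+ 2 = 1 by rewrite sqrrD sqrrB w2; lra.
have kI : -1 <= w - c <= 1.
  rewrite -ler_norml -(@ler_pXn2r _ 2)// ?nnegrE// expr1n real_normK ?num_real//.
  by rewrite -sk1 lerDr sqr_ge0.
have ks : Num.sqrt (1 - (w - c) ^+ 2) = `|c + w|.
  by rewrite -sk1 addrK sqrtr_sqr.
(* [acos] gives an angle with nonnegative sine, so a negative c + w calls for the opposite angle. *)
have [s0|s0] := leP 0 (c + w).
  exists (acos (w - c)); rewrite /osc sin_acos// acosK ?in_itv//= ks ger0_norm//.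
  lra.
exists (- acos (w - c)); rewrite /osc sinN cosN sin_acos// acosK ?in_itv//= ks ltr0_norm//.
lra.
Qed.

Definition psi (t : R) : R := sin (ln (ln (expR 1 / t))).

Lemma psi_le1 t : `|psi t| <= 1.
Proof. by rewrite /psi ler_norml sin_le1 sin_geN1. Qed.

Lemma psiE t : 0 < t -> psi t = sin (ln (1 - ln t)).
Proof.
by move=> t0; rewrite /psi lnM ?posrE ?expR_gt0 ?invr_gt0// expRK lnV ?posrE.
Qed.

Lemma measurable_psi : measurable_fun [set: lebT R] (psi : lebT R -> R).
Proof.
apply: (measurable_fun_leb measurableT).
apply: (@measurableT_comp _ _ _ _ _ _ (@sin R)).
  by apply: continuous_measurable_fun; exact: continuous_sin.
apply: (measurableT_comp (@measurable_ln R)).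
apply: (measurableT_comp (@measurable_ln R)).
by apply: measurable_funM => //; exact: measurable_invr.
Qed.

Lemma continuous_psi_div (t : R) : 0 < t <= 1 ->
  {for t, continuous (fun t : R => sin (ln (1 - ln t)) / t)}.
Proof.
move=> /andP[t0 t1].
have v1 : 1 <= 1 - ln t by rewrite lerBrDr gerDl ln_le0.
have v0 : 0 < 1 - ln t by exact: lt_le_trans v1.
apply: cvgM; last by apply: cvgV; [rewrite gt_eqF|exact: cvg_id].
apply: continuous_comp; last exact: continuous_sin.
apply: (@continuous_comp _ _ _ (fun t => 1 - ln t) (@ln R)); last exact: continuous_ln.
by apply: cvgB; [exact: cvg_cst|exact: continuous_ln].
Qed.

Lemma integral_mu n (E : set (lebT R)) (f : lebT R -> \bar R) :
  measurable E -> measurable_fun E f ->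
  (\int[mu_ R n]_(t in E) f t = \int[leb01 R]_(t in E) (f t * (z_ R n t)%:E))%E.
Proof.
move=> mE mf; apply: integral_density => //; first exact: measurable_z_.
by move=> t; exact: z__ge0.
Qed.

(** Since z_n = lambda0 (1/t - 1), the integral is lambda0 times that of psi / t minus that of psi.
    The former is explicit through [is_derive_osc_ln], the latter is at most 1 in absolute value. *)
Lemma integral_psi_mu n : (2 <= n)%N ->
  `|\int[mu_ R n]_(t in (`[0, 1]%classic : set R)) psi t
    - osc (ln (1 + ln n%:R))| <= lambda0_ R n * 3.
Proof.
move=> n2; have /andP[n0 n1] := invn_itv R n2; have l0 := lambda0_gt0 R n2.
set I := (`[0, 1]%classic : set R); set J : set (lebT R) := (`[n%:R^-1, 1]%classic : set R).
have mJ : measurable J by exact: measurable_leb_itv.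
have Jfin : (leb J < +oo)%E.
  by rewrite -[X in (X < _)%E]/(lebesgue_measure J) lebesgue_measure_itv/= lte_fin n1
    -EFinD ltry.
have mpsi D : measurable_fun (D : set (lebT R)) (psi : lebT R -> R).
  exact: measurable_funTS measurable_psi.
have J01 t : J t -> 0 < t <= 1.
  by rewrite /J/= in_itv/= => /andP[nt ->]; rewrite (lt_le_trans n0).
pose g (t : R) := sin (ln (1 - ln t)) / t.
have gE t : J t -> g t = psi t / t by move=> /J01/andP[t0 _]; rewrite /g psiE.
have intpsi : leb.-integrable J (EFin \o psi).
  by apply: (@integrable_bounded _ _ _ _ _ _ 1 mJ Jfin (mpsi _)) => t _; exact: psi_le1.
have mg : measurable_fun J (g : lebT R -> R).
  apply: (measurable_fun_leb (measurable_itv `[n%:R^-1, 1])).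
  apply: (@measurable_fun_itv_continuous R n%:R^-1 1 g) => t nt.
  by apply: continuous_psi_div; apply: J01; rewrite /J/= in_itv.
have intg : leb.-integrable J (EFin \o g).
  apply: (@integrable_bounded _ _ _ _ _ _ n%:R mJ Jfin mg) => t /[dup] Jt /J01/andP[t0 _].
  rewrite gE// normrM -[leRHS]mul1r ler_pM// ?psi_le1// gtr0_norm ?invr_gt0//.
  rewrite invf_ple ?posrE// ?ltr0n ?(leq_trans _ n2)//.
  by move: Jt; rewrite /J/= in_itv/= => /andP[].
have -> : \int[mu_ R n]_(t in I) psi t =
    lambda0_ R n * (\int[leb]_(t in J) g t - \int[leb]_(t in J) psi t).
  have intB : leb.-integrable J (EFin \o (fun t => g t - psi t)).
    exact: (integrableB mJ intg intpsi).
  rewrite -(RintegralB mJ intg intpsi) -(RintegralZl _ mJ intB).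
  congr fine.
  have mpE : measurable_fun (I : set (lebT R)) (EFin \o psi) by exact/measurable_EFinP.
  rewrite (@integral_mu n _ _ (@measurable01 R) mpE).
  rewrite integral_lebI; last 2 first.
  - exact: measurable01.
  - by apply: emeasurable_funM; apply/measurable_EFinP => //; apply: measurable_funTS;
    exact: measurable_z_.
  rewrite setIid [LHS]integral_mkcond [RHS]integral_mkcond; apply: eq_integral => t _.
  rewrite /patch !mem_setE !in_itv/= /z_.
  have [nt|_] := boolP (n%:R^-1 <= t <= 1); last by rewrite mule0 if_same.
  have Jt : J t by rewrite /J/= in_itv.
  have /andP[t0 t1] := J01 _ Jt; rewrite (ltW t0) t1/= gE// -EFinM; congr EFin.
  by field; rewrite gt_eqF.
have -> : \int[leb]_(t in J) g t =
    (1 + ln n%:R) * osc (ln (1 + ln n%:R)) - osc 0.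
  have nt01 (t : R) : n%:R^-1 <= t <= 1 -> 0 < t <= 1.
    by move=> nt; apply: J01; rewrite /J/= in_itv.
  have dG t (nt : n%:R^-1 <= t <= 1) := is_derive_osc_ln (nt01 t nt).
  have cG t (nt : n%:R^-1 <= t <= 1) := continuous_psi_div (nt01 t nt).
  rewrite /Rintegral (integral_leb_FTC (ltW n1) dG cG)/=.
  by rewrite ln1 subr0 ln1 mul1r lnV ?posrE -1?invr_gt0// opprK opprK addrC.
set o := osc (ln _); set P := \int[leb]_(t in J) psi t.
have P1 : `|P| <= 1.
  rewrite (le_trans (le_normr_Rintegral mJ intpsi))//.
  rewrite (le_trans (Rintegral_le_cst mJ Jfin (integrable_norm intpsi) (fun t _ =>
    psi_le1 t)))// mul1r.
  rewrite [X in fine X](_ : _ = (1 - n%:R^-1)%:E); first by rewrite /= gerBl ltW.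
  by rewrite -[LHS]/(lebesgue_measure J) lebesgue_measure_itv/= lte_fin n1 -EFinD.
(* As lambda0 is the inverse of ln n + 1/n, subtracting o turns the factor 1 + ln n into 1 - 1/n.
   Each of the three terms left is at most 1 in absolute value, whence the constant 3. *)
have -> : lambda0_ R n * ((1 + ln n%:R) * o - osc 0 - P) - o =
   lambda0_ R n * ((1 - n%:R^-1) * o - osc 0 - P).
  rewrite lambda0_E//.
  have : 0 < ln n%:R + n%:R^-1 :> R by move: l0; rewrite lambda0_E// invr_gt0.
  by move: (n%:R^-1) => m h; field; rewrite gt_eqF.
rewrite normrM gtr0_norm// ler_wpM2l ?(ltW l0)//.
apply: (le_trans (ler_normB _ _)).
rewrite (_ : 3 = 1 + 1 + 1 :> R); last by lra.
apply: lerD => //; apply: (le_trans (ler_normB _ _)); apply: lerD; last exact: osc_le1.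
rewrite normrM -[leRHS]mul1r ler_pM ?osc_le1//.
by rewrite ger0_norm ?subr_ge0 ?(ltW n1)// gerBl ltW.
Qed.

End oscillation.

Section cluster_psi.
Context (R : realType).

Lemma ln_le_subr1 (x : R) : 0 < x -> ln x <= x - 1.
Proof.
move=> x0; rewrite -[X in ln X](subrK 1) addrC; apply: le_ln1Dx; lra.
Qed.

(** The equation ln (1 + ln N) = theta + 2 k pi has the solution N = exp (V - 1) with V = exp (theta
    + 2 k pi), and n is the integer part of N. From N < n + 1 the inner logarithm loses at most 1/n,
    and the outer one does not enlarge this loss because 1 + ln n >= 1. *)
Lemma ln_ln_natr_approx (theta : R) (M : nat) : exists n k : nat,
  [/\ (M <= n)%N, (0 < n)%N & `|ln (1 + ln n%:R) - (theta + pi *+ 2 *+ k)| <= n%:R^-1].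
Proof.
(* Since 2 pi >= 1, this k gives theta + 2 k pi >= M + 1, hence M + 1 <= V <= N, which pushes n
   beyond M. *)
pose k := (Num.Def.trunc (`|theta| + M.+1%:R)).+1.
pose V := expR (theta + pi *+ 2 *+ k).
pose N := expR (V - 1).
have kV : M.+1%:R <= V.
  apply: (le_trans _ (expR_ge1Dx _)).
  have k1 : `|theta| + M.+1%:R < k%:R.
    by have /andP[_] := trunc_itv (addr_ge0 (normr_ge0 theta) (ler0n R M.+1)).
  have kpi : k%:R <= (pi : R) *+ 2 *+ k.
    rewrite -[leRHS]mulr_natr ler_peMl// mulr2n.
    by have := pi_ge2 R; lra.
  have : - theta <= `|theta| by rewrite -normrN ler_norm.
  lra.
have VN : V <= N by have := expR_ge1Dx (V - 1); rewrite addrC subrK.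
have N0 : 0 <= N by exact: expR_ge0.
pose n := Num.Def.trunc N.
have /andP[nN Nn] : n%:R <= N < n.+1%:R by exact: trunc_itv.
have Mn : (M < n.+1)%N.
  rewrite -(ltr_nat R); apply: le_lt_trans Nn; apply: le_trans VN.
  by apply: (le_trans _ kV); rewrite ler_nat.
have n_gt0 : (0 < n)%N.
  rewrite -ltnS -(ltr_nat R); apply: le_lt_trans Nn; apply: le_trans VN.
  by apply: (le_trans _ kV); rewrite ler_nat.
exists n, k; split => //.
have n0 : (0 : R) < n%:R by rewrite ltr0n.
have ln0 : 0 <= ln (n%:R : R) by rewrite ln_ge0// ler1n.
have lnN : ln N = V - 1 by rewrite expRK.
have V0 : 0 < V by exact: expR_gt0.
have lnV' : ln V = theta + pi *+ 2 *+ k by rewrite expRK.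
have N_gt0 : 0 < N by exact: expR_gt0.
have h1 : ln n%:R <= V - 1 by rewrite -lnN ler_ln.
have h2 : V - 1 <= ln n%:R + n%:R^-1.
  rewrite -lnN -lerBlDl -ln_div ?posrE//.
  apply: (le_trans (ln_le_subr1 (divr_gt0 N_gt0 n0))).
  rewrite lerBlDr ler_pdivrMr// mulrDl mul1r mulVf ?gt_eqF//.
  by rewrite addrC natr1 ltW.
rewrite -lnV' distrC ger0_norm; last first.
  by rewrite subr_ge0 ler_ln ?posrE//; lra.
rewrite -ln_div ?posrE//; last lra.
set v := 1 + ln n%:R.
have v1 : 1 <= v by rewrite /v; lra.
have v0 : 0 < v by lra.
apply: (le_trans (ln_le_subr1 (divr_gt0 V0 v0))).
have -> : V / v - 1 = (V - v) / v by rewrite mulrBl divff// gt_eqF//; lra.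
rewrite ler_pdivrMr; last lra.
apply: (@le_trans _ _ n%:R^-1); first by rewrite /v; lra.
by rewrite ler_peMr ?invr_ge0// ltW.
Qed.

Lemma cluster_psi (c : R) : - (Num.sqrt 2 / 2) <= c <= Num.sqrt 2 / 2 ->
  cluster ((fun n => \int[mu_ R n]_(t in (`[0, 1]%classic : set R))
    sin (ln (ln (expR 1 / t)))) @ \oo) c.
Proof.
move=> /osc_onto[theta <-]; apply/cluster_eventuallyP => e n0 e0.
have e20 : 0 < e / 2 by rewrite divr_gt0.
have [d /= d0 oscd] : nbhs theta (fun v => `|osc theta - osc v| <= e / 2).
  by have /cvgrPdist_le/(_ _ e20) := @continuous_osc R theta.
have [N _ NP] : \forall n \near \oo, [/\ lambda0_ R n * 3 <= e / 2, n%:R^-1 < d,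
  (2 <= n)%N & (n0 <= n)%N].
  have := lambda0_mulr_cvg0 (3 : R) => /cvgrPdist_le /(_ _ e20) h.
  have := @invr_natr_cvg0 R => /cvgrPdist_lt /(_ _ d0) h'.
  near=> n; split.
  - suff : `|0 - lambda0_ R n * 3| <= e / 2 by rewrite sub0r normrN; apply: le_trans;
    exact: ler_norm.
    by near: n.
  - suff : `|0 - n%:R^-1| < d by rewrite sub0r normrN; apply: le_lt_trans; exact: ler_norm.
    by near: n.
  - by near: n; exact: nbhs_infty_ge.
  - by near: n; exact: nbhs_infty_ge.
have [n [k [Nn n_gt0 vk]]] := ln_ln_natr_approx theta N.
have [l3 nd n2 n0n] := NP n Nn.
exists n => //.
have := le_trans (integral_psi_mu R n2) l3; rewrite /psi; set I := \int[_]_(_ in _) _ => Io.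
(* The multiple of 2 pi is subtracted from the argument, which brings it within 1/n < d of theta;
   periodicity of [osc] then removes it again. *)
have : `|osc theta - osc (ln (1 + ln (n%:R : R)) - pi *+ 2 *+ k)| <= e / 2.
  apply: oscd => /=; rewrite opprB addrA distrC.
  by apply: le_lt_trans nd.
rewrite -(oscD2pin (_ - _) k) subrK => to.
rewrite [leRHS]splitr (_ :
  osc theta - I = (osc theta - osc (ln (1 + ln n%:R))) - (I - osc (ln (1 + ln n%:R))));
    last by ring.
apply: (le_trans (ler_normB _ _)); exact: lerD.
Unshelve. all: by end_near. Qed.

End cluster_psi.

(** * Pure charges at the origin *)

Section charge_of_additive.
Context d (T : measurableType d) (R : realType) (v : set T -> R).
Hypothesis v0 : v set0 = 0.
Hypothesis vU : forall A B, measurable A -> measurable B -> A `&` B = set0 ->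
  v (A `|` B) = v A + v B.

Definition EFin_set_fun (E : set T) : \bar R := (v E)%:E.

Let v_semi_additive : measure_function.semi_additive EFin_set_fun.
Proof.
apply/additive2P; first by rewrite /EFin_set_fun v0.
by move=> A B mA mB AB; rewrite /EFin_set_fun vU.
Qed.

Let v_fin : fin_num_fun EFin_set_fun.
Proof. by []. Qed.

HB.instance Definition _ := measure_function.isFinite.Build _ _ _ EFin_set_fun v_fin.
HB.instance Definition _ := isAdditiveCharge.Build _ _ _ EFin_set_fun v_semi_additive.

(** Banach limits and functionals on [Linf] both yield a real set function whose additivity is
    checked on two disjoint sets at a time; that suffices for a charge. *)
Lemma additive_charge_of : exists w : {additive_charge set T -> \bar R},
  forall E, w E = (v E)%:E.
Proof. by exists EFin_set_fun. Qed.

End charge_of_additive.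

Section pure_charges.
Context (R : realType).
Local Open Scope ereal_scope.
Implicit Types w : {additive_charge set (lebT R) -> \bar R}.

Lemma additive_charge0 w : w set0 = 0.
Proof.
have /[!big_ord0] ->// := @charge_semi_additive _ _ _ w (fun=> set0) 0%N.
exact: trivIset_set0.
Qed.

Lemma additive_chargeU w (A B : set (lebT R)) : measurable A -> measurable B ->
  A `&` B = set0 -> w (A `|` B) = w A + w B.
Proof.
have /additive2P := @charge_semi_additive _ _ _ w.
by move=> /(_ (additive_charge0 w)); apply.
Qed.

Lemma le_additive_charge w (A B : set (lebT R)) :
  (forall E, measurable E -> 0 <= w E) ->
  measurable A -> measurable B -> A `<=` B -> w A <= w B.
Proof.
move=> w_ge0 mA mB AB; rewrite -(setUIDK B A) additive_chargeU.
- by rewrite setIidr// leeDl// w_ge0//; exact: measurableD.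
- exact: measurableI.
- exact: measurableD.
- by rewrite setDE setIACA setICr setI0.
Qed.

(** Covers at once the complement of [0, 1] and the origin itself: within [0, 1] such a set is
    contained in {0}, of length 0. *)
Lemma leb01_null (A : set (lebT R)) : measurable A ->
  A `&` (`[0%R, 1%R]%classic : set R) `<=` [set 0%R : R] -> (leb01 R).-null_set A.
Proof.
move=> mA A0 B mB BA; apply/eqP; rewrite eq_le measure_ge0 andbT.
apply: (@le_trans _ _ (leb01 R (`[0%R, 0%R]%classic : set R))); last first.
  by rewrite lebI_itv// subrr.
rewrite !lebIE; apply: le_measure; rewrite ?inE.
- by apply: measurableI => //; exact: measurable01.
- by apply: measurableI; exact: measurable_leb_itv.
- move=> t [/BA At t01]; have -> : t = 0%R by exact: A0.
  by rewrite /= !in_itv/= lexx ler01.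
Qed.

(** The hypotheses only constrain the masses of individual sets, so they can be checked for a
    generalized limit one set at a time. *)
Lemma pure_at_originI w : (forall E, measurable E -> 0 <= w E) ->
  w `<< leb01 R ->
  (forall e : R, (0 < e < 1)%R -> w (`[e, 1%R]%classic : set R) = 0) ->
  w (`[0%R, 1%R]%classic : set R) = 1 -> pure_at_origin w.
Proof.
move=> w_ge0 w_dom w_far w1.
have m01 := @measurable01 R.
have mC01 : measurable (~` (`[0%R, 1%R]%classic : set R) : set (lebT R)).
  exact: measurableC.
have wC01 : w (~` (`[0%R, 1%R]%classic : set R)) = 0.
  apply: (w_dom (~` (`[0%R, 1%R]%classic : set R))) => //.
  by apply: leb01_null => //; rewrite setICl.
have wT : w setT = 1.
  rewrite -(setUv (`[0%R, 1%R]%classic : set R)) additive_chargeU ?setICr//.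
  by rewrite w1 wC01 adde0.
have w0 : w (`[0%R, 0%R]%classic : set R) = 0.
  have m0 := @measurable_leb_itv R `[0%R, 0%R].
  apply: (w_dom (`[0%R, 0%R]%classic : set R)) => //.
  apply: leb01_null => // t [/=]; rewrite in_itv/= => /andP[t0 t0'] _.
  by apply/le_anti; rewrite t0 t0'.
split => //.
- split => //; exists 1%R => E mE.
  by rewrite gee0_abs ?w_ge0// -wT; apply: le_additive_charge.
- split=> // m mw E mE.
  (* The shift by 2 keeps 1/(k + 2) strictly between 0 and 1, as [w_far] requires. *)
  pose F (k : nat) : set (lebT R) := (`[k.+2%:R^-1%R, 1%R]%classic : set R).
  have mN (A : set (lebT R)) : measurable A -> w A = 0 -> m.-negligible A.
    move=> mA wA; exists A; split => //; apply/eqP; rewrite eq_le measure_ge0 andbT.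
    by rewrite -wA; exact: mw.
  (* Countable additivity of [m] enters here: the countable union is negligible for [m] because each
     piece is, although the same union has full mass for [w]. *)
  have : m.-negligible (~` (`[0%R, 1%R]%classic : set R) `|`
      ((`[0%R, 0%R]%classic : set R) `|` \bigcup_k F k)).
    apply: negligibleU; first exact: mN.
    apply: negligibleU; first by apply: mN => //; exact: measurable_leb_itv.
    apply: negligible_bigcup => k; apply: mN; first exact: measurable_leb_itv.
    exact/w_far/invn_itv.
  move=> /(@negligibleS _ _ _ _ _ E)[t _|N [mNN N0 EN]]; last first.
    by apply/eqP; rewrite eq_le measure_ge0 andbT -N0 le_measure ?inE.
  have [t01|t01] := pselect ((`[0%R, 1%R]%classic : set R) t); last by left.
  move: t01; rewrite /= in_itv/= => /andP[]; rewrite le_eqVlt => /predU1P[<- _|t0 t1].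
    by right; left; rewrite /= in_itv/= lexx.
  right; right; exists (Num.Def.trunc (t^-1)%R) => //.
  rewrite /F /= in_itv/= t1 andbT invf_ple ?posrE//.
  have tV0 : (0 <= t^-1)%R by rewrite invr_ge0 ltW.
  by have /andP[_ /ltW/le_trans->//] := trunc_itv tV0; rewrite ler_nat.
(* [w_far] speaks of e < 1, so e is lowered to e' and monotonicity leads back to e. The unit
   interval splits into {0}, ]0, e'[ and [e', 1], of which the outer two have mass 0. *)
- move=> e e0; pose e' := Num.min e (1 / 2)%R.
  have [e'0 e'1] : (0 < e' /\ e' < 1)%R.
    by rewrite lt_min gt_min e0/=; split; [lra|apply/orP; right; lra].
  have m0e : measurable ((`]0%R, e[%classic : set R) : set (lebT R)).
    exact: measurable_leb_itv.
  have m0e' : measurable ((`]0%R, e'[%classic : set R) : set (lebT R)).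
    exact: measurable_leb_itv.
  have m00 : measurable ((`[0%R, 0%R]%classic : set R) : set (lebT R)).
    exact: measurable_leb_itv.
  have me'1 : measurable ((`[e', 1%R]%classic : set R) : set (lebT R)).
    exact: measurable_leb_itv.
  rewrite w1; apply/le_anti/andP; split.
    by rewrite -wT; apply: le_additive_charge.
  apply: (@le_trans _ _ (w (`]0%R, e'[%classic : set R))); last first.
    apply: le_additive_charge => // t /=; rewrite !in_itv/= => /andP[-> te].
    by rewrite (lt_le_trans te)// ge_min lexx.
  rewrite -w1 -[leRHS]add0e -[X in _ <= X + _]w0 -[leRHS]adde0 -[X in _ <= _ + X](w_far
    e') ?e'0//.
  rewrite -additive_chargeU//; last first.
    by apply/seteqP; split => // t [/=];
      rewrite !in_itv/= => /andP[_ t0] /andP[/lt_le_trans/(_ t0)]; rewrite ltxx.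
  rewrite -additive_chargeU//; last 2 first.
  - exact: measurableU.
  - apply/seteqP; split => // t [/=]; rewrite !in_itv/=.
    move=> [/andP[_ t0]|/andP[_ te]] /andP[/[dup] et /le_lt_trans h _].
      by have := lt_le_trans e'0 (le_trans et t0); rewrite ltxx.
    by have := h _ te; rewrite ltxx.
  apply: le_additive_charge => //; first by apply: measurableU => //; exact: measurableU.
  move=> t /=; rewrite !in_itv/= => /andP[]; rewrite le_eqVlt => /predU1P[<- _|t0 t1].
    by left; left; rewrite eqxx lexx.
  by have [te|et] := ltP t e'; [left; right; rewrite t0|right; apply/andP; split].
Qed.

Lemma pure_at_origin_ext w w' : (forall E, measurable E -> w E = w' E) ->
  pure_at_origin w -> pure_at_origin w'.
Proof.
move=> ww' [[w_dom [M wM]] [w_ge0 w_pure] we w1]; split.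
- split; last by exists M => E mE; rewrite -ww'// wM.
  by move=> A A0 B mB BA; rewrite -ww'//; exact: w_dom BA.
- split; first by move=> E mE; rewrite -ww'// w_ge0.
  by move=> m mw; apply: w_pure => E mE; rewrite ww'// mw.
- move=> e e0; rewrite -!ww'; [exact: we|exact: measurable01|exact: measurable_leb_itv].
- by rewrite -ww'//; exact: measurable01.
Qed.

End pure_charges.

(** * Banach limits of the masses *)

Section banach.
Context (R : realType).

Lemma mu_null n (E : set (lebT R)) : measurable E -> leb01 R E = 0%E ->
  mu_ R n E = 0%E.
Proof.
move=> mE E0; apply: null_set_integral => //.
by apply/measurable_EFinP; apply: measurable_funTS; exact: measurable_z_.
Qed.

Lemma mu01_cvg1 :
  (fun n => fine (mu_ R n (`[0%R, 1%R]%classic : set R))) @ \oo --> (1 : R).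
Proof.
have : (fun n => 1 - lambda0_ R n) @ \oo --> (1 - 0 : R).
  by apply: cvgB; [exact: cvg_cst|exact: lambda0_cvg0].
rewrite subr0; apply: cvg_trans; apply: near_eq_cvg; near=> n.
by rewrite mu01//; near: n; exact: nbhs_infty_ge.
Unshelve. all: by end_near. Qed.

Lemma bounded_funI (u : nat -> R) (M : R) : (forall k, `|u k| <= M) -> bounded_fun u.
Proof.
move=> uM; exists M; split; first exact: num_real.
by move=> x Mx k _ /=; rewrite (le_trans (uM k))// ltW.
Qed.

Variable B : (nat -> R) -> R.
Hypothesis BL : banach_limit B.

Let Blin (a : R) (u v : nat -> R) : bounded_fun u -> bounded_fun v ->
  B (fun k => a * u k + v k) = a * B u + B v.
Proof. by case: BL => h _ _ _; exact: h. Qed.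

Let bounded_cst (c : R) : bounded_fun (fun _ : nat => c).
Proof. exact: (@bounded_funI _ `|c|). Qed.

Lemma banach_limit_cst (c : R) : B (fun=> c) = c.
Proof.
have := Blin (c - 1) (bounded_cst 1) (bounded_cst 1).
by case: BL => _ _ -> _; rewrite mulr1 subrK.
Qed.

Lemma banach_limitD (u v : nat -> R) : bounded_fun u -> bounded_fun v ->
  B (fun k => u k + v k) = B u + B v.
Proof.
move=> bu bv; have := Blin 1 bu bv; rewrite mul1r => <-.
by congr B; apply/funext => k; rewrite mul1r.
Qed.

Lemma banach_limit_shift (u : nat -> R) (K : nat) : bounded_fun u ->
  B (fun k => u (k + K)%N) = B u.
Proof.
elim: K u => [|K IH] u bu; first by congr B; apply/funext => k; rewrite addn0.
have bu1 : bounded_fun (fun k => u k.+1).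
  case: bu => M [Mreal uM]; exists M; split => // x Mx k _.
  exact: (uM _ Mx k.+1).
case: (BL) => _ _ _ shift; rewrite -(shift u bu) -(IH _ bu1).
by congr B; apply/funext => k; rewrite addnS.
Qed.

(** Shift invariance discards the first K terms, after which l - e <= u <= l + e; positivity applied
    to u - (l - e) and (l + e) - u brings B u within e of l. *)
Lemma banach_limit_cvg (u : nat -> R) (l : R) : bounded_fun u ->
  u @ \oo --> l -> B u = l.
Proof.
move=> bu ul; have Bpos := let: And4 _ h _ _ := BL in h.
have [le1 le2] : B u <= l /\ l <= B u; last by apply/le_anti; rewrite le1.
suff h e : 0 < e -> B u <= l + e /\ l <= B u + e.
  by split; apply/ler_addgt0Pr => e /h [].
move=> e0; have /cvgrPdist_le/(_ _ e0)[K _ uK] := ul.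
have buK : bounded_fun (fun k => u (k + K)%N).
  case: bu => M [Mreal uM]; exists M; split => // x Mx k _.
  exact: (uM _ Mx (k + K)%N).
have lu k : `|l - u (k + K)%N| <= e by apply: uK => /=; exact: leq_addl.
have b1 (c a : R) : bounded_fun (fun k => a * u (k + K)%N + c).
  apply: (@bounded_funI _ (`|a| * (`|l| + e) + `|c|)) => k.
  apply: (le_trans (ler_normD _ _)); rewrite lerD2r normrM ler_wpM2l//.
  rewrite -[X in `|X|](subKr l); apply: (le_trans (ler_normB _ _)).
  by rewrite lerD2l.
split.
- have : 0 <= B (fun k => (-1) * u (k + K)%N + (l + e)).
    apply: Bpos => [|k]; first exact: b1.
    by have := lu k; rewrite ler_norml => /andP[h1 h2]; lra.
  by rewrite Blin// banach_limit_shift// banach_limit_cst; lra.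
- have : 0 <= B (fun k => 1 * u (k + K)%N + (e - l)).
    apply: Bpos => [|k]; first exact: b1.
    by have := lu k; rewrite ler_norml => /andP[h1 h2]; lra.
  by rewrite Blin// banach_limit_shift// banach_limit_cst; lra.
Qed.

Lemma blim_cvg (u : nat -> R) (l : R) : bounded_fun (fun k => u k.+2) ->
  u @ \oo --> l -> blim B u = l.
Proof.
move=> bu ul; apply: banach_limit_cvg => //.
have : (fun k => u (k + 2)%N) @ \oo --> l by rewrite cvg_shiftn.
by under eq_fun do rewrite addn2.
Qed.

Let muB (E : set (lebT R)) (k : nat) := fine (mu_ R k.+2 E).

Let muB_bounded (E : set (lebT R)) : measurable E -> bounded_fun (muB E).
Proof.
move=> mE; apply: (@bounded_funI _ 1) => k; rewrite /muB ger0_norm ?fine_ge0//.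
have h := mu_le1 (isT : (2 <= k.+2)%N) mE.
by rewrite -lee_fin fineK// ge0_fin_numE// (le_lt_trans h)// ltry.
Qed.

Lemma banach_charge_exists : exists w : {additive_charge set (lebT R) -> \bar R},
  banach_charge B w.
Proof.
have [w wE] : exists w : {additive_charge set (lebT R) -> \bar R},
    forall E, w E = (B (muB E))%:E.
  apply: additive_charge_of.
    rewrite (_ : muB set0 = fun=> 0) ?banach_limit_cst//.
    by apply/funext => k; rewrite /muB measure0.
  move=> A C mA mC AC; rewrite -banach_limitD; [|exact: muB_bounded|exact: muB_bounded].
  congr B; apply/funext => k; rewrite /muB measureU//.
  have fin D : measurable D -> mu_ R k.+2 D \is a fin_num.
    move=> mD; have h := mu_le1 (isT : (2 <= k.+2)%N) mD.
    by rewrite ge0_fin_numE// (le_lt_trans h)// ltry.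
  by rewrite fineD ?fin.
by exists w => E mE; rewrite wE.
Qed.

Lemma banach_charge_pure (w : {additive_charge set (lebT R) -> \bar R}) :
  banach_charge B w -> pure_at_origin w.
Proof.
move=> wE; have m01 := @measurable01 R.
apply: pure_at_originI.
- move=> E mE; rewrite wE// lee_fin; case: BL => _ + _ _; apply; first exact: muB_bounded.
  by move=> k; rewrite fine_ge0.
- move=> A A0 C mC CA; rewrite wE//; congr EFin; rewrite -[RHS]banach_limit_cst.
  by congr B; apply/funext => k; rewrite mu_null//; exact: A0.
- move=> e e01; rewrite wE; last exact: measurable_leb_itv.
  congr EFin; apply: blim_cvg; first by apply: muB_bounded; exact: measurable_leb_itv.
  by have /fine_cvg := mu_tail_cvg0 e01.
- rewrite wE//; congr EFin; apply: blim_cvg; first exact: muB_bounded.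
  exact: mu01_cvg1.
Qed.

End banach.

(** * Weak* limits on [Linf] and the charges that represent them *)

Section weakstar.
Context (R : realType).

Lemma cluster_comp (T U : topologicalType) (F : set_system T) (f : T -> U) (x : T) :
  {for x, continuous f} -> cluster F x -> cluster (f @ F) (f x).
Proof.
move=> cf Fx A C FA Cfx.
have [t [At Ct]] := Fx (f @^-1` A) (f @^-1` C) FA (cf C Cfx).
by exists (f t).
Qed.

Lemma weakstar_cluster_eval (Phi : Linf R -> R) (g : Linf R) :
  weakstar_cluster (@int_mu R) Phi ->
  cluster ((fun n => int_mu n g) @ \oo) (Phi g).
Proof.
move=> [_ cl].
exact: (@cluster_comp _ _ _ (fun u : {ptws Linf R -> R} => u g) _
  (@proj_continuous _ _ g Phi) cl).
Qed.

(** Tails and preimages of neighbourhoods of the limit all belong to the proper filter [F], so they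
    meet. Results on cluster points thereby cover all subnets. *)
Lemma weakstar_cvg_cluster (F : set_system nat) (Phi : Linf R -> R) :
  subnet F -> weakstar_cvg F (@int_mu R) Phi -> weakstar_cluster (@int_mu R) Phi.
Proof.
move=> [PF Foo] [dPhi cPhi]; split => //.
move=> A C nA nC.
have FA : F ((@int_mu R) @^-1` A) by exact: Foo.
have FC : F ((@int_mu R) @^-1` C) by exact: cPhi.
have [n [An Cn]] := @filter_ex _ F _ _ (filterI FA FC).
by exists (int_mu n).
Qed.

(** R is Hausdorff. Through this lemma a mass that converges takes the same value at every weak*
    cluster point. *)
Lemma cluster_cvg_eq (u : nat -> R) (c l : R) :
  cluster (u @ \oo) c -> u @ \oo --> l -> c = l.
Proof.
move=> cu ul; have : cluster (nbhs l) c by exact: cvg_cluster cu.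
by move=> lc; apply/esym; exact: Rhausdorff lc.
Qed.

Lemma cluster_ge0 (u : nat -> R) (c : R) :
  cluster (u @ \oo) c -> (forall n, 0 <= u n) -> 0 <= c.
Proof.
move=> /cluster_eventuallyP cu u0; apply/ler_addgt0Pr => e e0.
have [n _] := cu e 0%N e0; rewrite ler_norml => /andP[h _].
have := u0 n; lra.
Qed.

Lemma Lfun_infty_bounded (f : lebT R -> R) (M : R) : measurable_fun setT f ->
  0 <= M -> (forall t, `|f t| <= M) -> f \in Lfun (leb01 R) +oo%E.
Proof.
move=> mf M0 fM; rewrite inE/=; apply/andP; split; rewrite inE//=.
rewrite /finite_norm (@le_lt_trans _ _ M%:E)// ?ltry//.
apply: Lnorm_infty_lebI_le => //; exact: nearW_lebI.
Qed.

Lemma Lfun_infty_indic (E : set (lebT R)) : measurable E ->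
  (\1_E : lebT R -> R) \in Lfun (leb01 R) +oo%E.
Proof.
move=> mE; apply: (@Lfun_infty_bounded _ 1) => //.
by move=> t; rewrite indicE; case: (_ \in _); rewrite ?normr1 ?normr0.
Qed.

Definition indL (E : set (lebT R)) (mE : measurable E) : Linf R :=
  Lfun_Sub (leey 1%E) (Lfun_infty_indic mE).

Lemma int_mu_indL n (E : set (lebT R)) (mE : measurable E) :
  int_mu n (indL mE) = fine (mu_ R n E).
Proof.
by rewrite /int_mu/= /Rintegral; congr fine;
  rewrite (integral_indic _ measurableT mE) setIT.
Qed.

Lemma weakstar_cvg_eval (F : set_system nat) (Phi : Linf R -> R) (g : Linf R) :
  weakstar_cvg F (@int_mu R) Phi -> (fun n => int_mu n g) @ F --> Phi g.
Proof.
move=> [_ cPhi].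
have cg := @proj_continuous (Linf R) (fun=> R) g Phi.
exact: (cvg_comp (@int_mu R) (fun u : {ptws Linf R -> R} => u g) cPhi cg).
Qed.

Lemma Lfun_infty_psi : (@psi R : lebT R -> R) \in Lfun (leb01 R) +oo%E.
Proof. exact: (Lfun_infty_bounded (@measurable_psi R) ler01 (@psi_le1 R)). Qed.

Definition psiL : Linf R := Lfun_Sub (leey 1%E) Lfun_infty_psi.

Lemma int_mu01 n (g : Linf R) :
  int_mu n g = \int[mu_ R n]_(t in (`[0, 1]%classic : set R)) g t.
Proof.
have mg : measurable_fun setT (EFin \o (g : lebT R -> R)).
  by apply/measurable_EFinP; exact: measurable_funP.
have mgz D : measurable_fun (D : set (lebT R)) (fun t => (g t)%:E * (z_ R n t)%:E)%E.
  apply: emeasurable_funM; first exact: measurable_funTS mg.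
  by apply: measurable_funTS; exact/measurable_EFinP/measurable_z_.
have m01 := @measurable01 R.
rewrite /int_mu /Rintegral; congr fine.
rewrite (@integral_mu _ n _ _ measurableT mg).
rewrite (@integral_mu _ n _ _ m01 (measurable_funTS mg)).
by rewrite (integral_lebI _ _ measurableT (mgz _)) (integral_lebI _ _ m01 (mgz _)) setTI
  setIid.
Qed.

(** Evaluation at [psiL] would make the integrals of [psi] converge, whereas sqrt 2 / 2 and its
    opposite are distinct cluster points of them. *)
Lemma weakstar_not_cvg : ~ exists Phi : Linf R -> R, weakstar_cvg \oo (@int_mu R) Phi.
Proof.
move=> [Phi cPhi]; have := @weakstar_cvg_eval _ Phi psiL cPhi.
under eq_fun do rewrite int_mu01/=.
move=> h; have s0 : (0 : R) <= Num.sqrt 2 / 2 by rewrite divr_ge0 ?sqrtr_ge0.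
have s1 : - (Num.sqrt 2 / 2) <= Num.sqrt 2 / 2 :> R by rewrite (le_trans _ s0)// oppr_le0.
have h1 := @cluster_psi R (Num.sqrt 2 / 2); have h2 := @cluster_psi R (- (Num.sqrt 2 / 2)).
have := cluster_cvg_eq (h1 _) h; have := cluster_cvg_eq (h2 _) h.
rewrite !lexx s1 => /(_ isT) <- /(_ isT) /eqP.
rewrite -subr_eq0 opprK -mulrDl mulf_eq0 invr_eq0 pnatr_eq0 orbF.
by rewrite -mulr2n mulrn_eq0/= sqrtr_eq0 leNgt ltr0n.
Qed.

Section dual.
Variable Phi : Linf R -> R.
Hypothesis dPhi : Lfun_dual Phi.

Lemma Lfun_dual_linear (a : R) (u v : Linf R) : Phi (a *: u + v) = a * Phi u + Phi v.
Proof. by case: dPhi => + _; apply. Qed.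

Lemma Lfun_dual0 : Phi 0 = 0.
Proof. by have := Lfun_dual_linear (-1) 0 0; rewrite scaler0 addr0 mulN1r addNr. Qed.

Lemma Lfun_dual_sum (I : Type) (r : seq I) (a : I -> R) (f : I -> Linf R) :
  Phi (\sum_(i <- r) a i *: f i) = \sum_(i <- r) a i * Phi (f i).
Proof.
elim: r => [|i r IH]; first by rewrite !big_nil Lfun_dual0.
by rewrite !big_cons Lfun_dual_linear IH.
Qed.

Lemma Linf_sumE (I : Type) (r : seq I) (a : I -> R) (f : I -> Linf R) t :
  (\sum_(i <- r) a i *: f i : Linf R) t = \sum_(i <- r) a i * f i t.
Proof.
elim: r => [|i r IH]; first by rewrite !big_nil.
by rewrite !big_cons -IH.
Qed.

Lemma Lfun_dual_charge_exists : exists w : {additive_charge set (lebT R) -> \bar R},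
  forall E (mE : measurable E), w E = (Phi (indL mE))%:E.
Proof.
(* [indL] takes a proof of measurability, so [v] decides it, with default value 0. The choice of
   proof is immaterial: elements of [Linf] are determined by their functions. *)
pose v (E : set (lebT R)) := if pselect (measurable E) is left mE then Phi (indL mE) else 0.
have vE E (mE : measurable E) : v E = Phi (indL mE).
  rewrite /v; case: pselect => // mE'; congr Phi; exact/LfuneqP.
have [w wE] : exists w : {additive_charge set (lebT R) -> \bar R}, forall E, w E = (v E)%:E.
  apply: additive_charge_of.
    rewrite (vE _ measurable0) -Lfun_dual0; congr Phi; apply/LfuneqP => t /=.
    by rewrite indicE in_set0.
  move=> A C mA mC AC; rewrite (vE _ mA) (vE _ mC) (vE _ (measurableU _ _ mA mC)).
  rewrite -[X in _ = X + _]mul1r -Lfun_dual_linear; congr Phi; apply/LfuneqP => t /=.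
  rewrite -[RHS]/(1 * \1_A t + \1_C t) mul1r !indicE in_setU.
  case: (boolP (t \in A)) => tA; case: (boolP (t \in C)) => tC //=; rewrite ?addr0 ?add0r//.
  have : (A `&` C) t by split; exact: set_mem.
  by rewrite AC.
by exists w => E mE; rewrite wE vE.
Qed.

Variable w : {additive_charge set (lebT R) -> \bar R}.
Hypothesis wE : forall E (mE : measurable E), w E = (Phi (indL mE))%:E.

(** Both sides are the same finite sum over the range of [s], by linearity of [Phi] on the
    indicators of the level sets. *)
Lemma sintegral_Lfun_dual (s : {sfun lebT R >-> R}) : exists S : Linf R,
  (S : lebT R -> R) =1 s /\ fine (sintegral w s) = Phi S.
Proof.
have ms x : measurable (s @^-1` [set x]) by exact: measurable_funPTI.
exists (\sum_(x <- finmap.enum_fset (fset_set (range s))) x *: indL (ms x)); split.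
  by move=> t; rewrite Linf_sumE {1}fimfunE fsbig_finite.
rewrite sintegralET -(fsbig_widen (range s) setT)//; last first.
  move=> x [_ /= xs]; rewrite (_ : s @^-1` [set x] = set0) ?additive_charge0 ?mule0//.
  by apply/seteqP; split => // t /= stx; apply: xs; exists t.
rewrite fsbig_finite//=.
under eq_bigr do rewrite (wE (ms _)) -EFinM.
by rewrite sumEFin/= Lfun_dual_sum.
Qed.

Lemma Lfun_dual_represents : represents w Phi.
Proof.
move=> g e e0; have [M PhiM] := dPhi.2.
have M0 : 0 < `|M| + 1 by rewrite ltr_wpDl.
(* The bound on [Phi] by M times the norm suggests e / M; |M| + 1 is positive whatever M is. *)
exists (e / (`|M| + 1)); first by rewrite divr_gt0.
move=> s sN.
have [S [SE ->]] := sintegral_Lfun_dual s; rewrite distrC.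
have -> : Phi g - Phi S = Phi ((-1) *: S + g) by rewrite Lfun_dual_linear mulN1r addrC.
have := PhiM (-1 *: S + g).
set N := ('N[_]_+oo[_])%E => PhiN.
have NE : N = ('N[leb01 R]_+oo[EFin \o ((g : lebT R -> R) \- s)%R])%E.
  by apply: eq_Lnorm => t /=; rewrite -SE; congr EFin;
    rewrite -[LHS]/(-1 * S t + g t) mulN1r addrC.
have Nfin : N \is a fin_num.
  by rewrite ge0_fin_numE ?Lnorm_ge0// NE (lt_trans sN)// ltry.
have N0 : 0 <= fine N by rewrite fine_ge0// Lnorm_ge0.
move: sN PhiN; rewrite -NE -(fineK Nfin) -EFinM lte_fin lee_fin => Nd PhiN.
apply: (le_lt_trans PhiN); apply: (@le_lt_trans _ _ ((`|M| + 1) * fine N)).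
  by rewrite ler_wpM2r// (le_trans (ler_norm M))// lerDl.
by rewrite mulrC -ltr_pdivlMr.
Qed.

End dual.

End weakstar.

(** * Cluster points and uniqueness of the Yosida-Hewitt decomposition *)

Section cluster_points.
Context (R : realType).
Implicit Types (w : {additive_charge set (lebT R) -> \bar R}) (Phi : Linf R -> R).

Lemma sintegral_charge_indic w (E : set (lebT R)) :
  sintegral w (\1_E : lebT R -> R) = w E.
Proof.
rewrite sintegralET -(fsbig_widen [set 1 : R] setT)//; last first.
  move=> x [_ /= x1]; have [->|x0] := eqVneq x 0; first by rewrite mul0e.
  rewrite (_ : _ @^-1` [set x] = set0) ?additive_charge0 ?mule0//.
  apply/seteqP; split => // t /=; rewrite indicE; case: (_ \in _) => /= h.
    by apply: x1; rewrite -h.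
  by rewrite -h eqxx in x0.
rewrite fsbig_set1 mul1e; congr (w _); apply/seteqP; split => t /=; rewrite indicE.
  by case: (boolP (t \in E)) => [/set_mem//|_ /esym/eqP]; rewrite oner_eq0.
by move=> Et; rewrite mem_set.
Qed.

Lemma represents_indL w Phi : represents w Phi ->
  forall E (mE : measurable E), w E = (Phi (indL mE))%:E.
Proof.
move=> rep E mE.
have wfin : w E \is a fin_num by exact: fin_num_measure.
rewrite -(fineK wfin); congr EFin; apply/eqP; rewrite -subr_eq0 -normr_le0.
apply/ler_addgt0Pr => e e0; rewrite add0r.
have [d d0 wd] := rep (indL mE) e e0.
(* This simple function is at distance 0 from [indL mE], hence allowed for every [d], so [w E] is
   within every [e] of [Phi (indL mE)]. *)
pose s : {sfun lebT R >-> R} := @indic_sfun _ _ R E mE.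
have := wd s; rewrite (_ : (s : lebT R -> R) = \1_E)//.
rewrite sintegral_charge_indic => h; apply/ltW/h.
rewrite (@eq_Lnorm _ _ _ _ _ _ (cst 0%E)); first by rewrite Lnorm0.
by move=> t /=; rewrite subrr.
Qed.

(** Evaluation at an indicator is weak* continuous, so the masses of E cluster at [w E]. Positivity
    and the known limits on null sets, on [e, 1] and on [0, 1] then feed the criterion. *)
Lemma cluster_charge_pure Phi w : weakstar_cluster (@int_mu R) Phi ->
  (forall E (mE : measurable E), w E = (Phi (indL mE))%:E) -> pure_at_origin w.
Proof.
move=> cPhi wE.
have cE E (mE : measurable E) : cluster ((fun n => fine (mu_ R n E)) @ \oo) (Phi (indL mE)).
  have := @weakstar_cluster_eval _ Phi (indL mE) cPhi.
  by under eq_fun do rewrite int_mu_indL.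
apply: pure_at_originI.
- move=> E mE; rewrite (wE _ mE) lee_fin; apply: (cluster_ge0 (cE _ mE)) => n.
  by rewrite fine_ge0.
- move=> A A0 C mC CA; rewrite (wE _ mC); congr EFin.
  apply: (cluster_cvg_eq (cE _ mC)).
  under eq_fun do rewrite mu_null ?A0//.
  exact: cvg_cst.
- move=> e e01; have mE := @measurable_leb_itv R `[e, 1].
  rewrite (wE _ mE); congr EFin; apply: (cluster_cvg_eq (cE _ mE)).
  by have /fine_cvg := mu_tail_cvg0 e01.
- have m01 := @measurable01 R.
  rewrite (wE _ m01); congr EFin; apply: (cluster_cvg_eq (cE _ m01)).
  exact: mu01_cvg1.
Qed.

End cluster_points.

Section density_measure.
Context d (T : measurableType d) (R : realType).
Local Open Scope ereal_scope.
Variables (mu : {measure set T -> \bar R}) (h : T -> \bar R).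
Hypotheses (mh : measurable_fun setT h) (h0 : forall t, 0 <= h t).

Definition density_measure (E : set T) := \int[mu]_(t in E) h t.

Let density_measure0 : density_measure set0 = 0.
Proof. exact: integral_set0. Qed.

Let density_measure_ge0 E : 0 <= density_measure E.
Proof. exact: integral_ge0. Qed.

Let density_measure_sigma_additive : semi_sigma_additive density_measure.
Proof. exact: semi_sigma_additive_nng_induced. Qed.

HB.instance Definition _ := isMeasure.Build _ _ _ density_measure
  density_measure0 density_measure_ge0 density_measure_sigma_additive.

Lemma measure_of_density : exists m : {measure set T -> \bar R},
  forall E, m E = \int[mu]_(t in E) h t.
Proof. by exists density_measure. Qed.

End density_measure.

Section yosida_hewitt.
Context (R : realType).
Local Open Scope ereal_scope.
Implicit Types (w zeta : {additive_charge set (lebT R) -> \bar R}) (z : R -> R).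

Lemma charge_pos_id w (E : set (lebT R)) : (forall E, measurable E -> 0 <= w E) ->
  measurable E -> charge_pos w E = w E.
Proof.
move=> w0 mE; apply/le_anti/andP; split; last first.
  by apply: ereal_sup_ubound; exists E => //; split.
by apply: ge_ereal_sup => _ [F [mF FE] <-]; exact: le_additive_charge.
Qed.

Lemma charge_pos_opp0 w (E : set (lebT R)) : (forall E, measurable E -> 0 <= w E) ->
  charge_pos (fun E => - w E) E = 0.
Proof.
move=> w0; apply/le_anti/andP; split; last first.
  by apply: ereal_sup_ubound; exists set0; [split|rewrite additive_charge0 oppe0].
by apply: ge_ereal_sup => _ [F [mF FE] <-]; rewrite oppe_le0 w0.
Qed.

(** The Jordan parts of a positive charge are the charge itself and 0. *)
Lemma positive_pure_pure w : positive_pure w -> pure w.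
Proof.
move=> [w0 wp]; split; split.
- by move=> E mE; rewrite charge_pos_id// w0.
- move=> m mw; apply: wp => E mE.
  by rewrite -charge_pos_id//; exact: mw.
- by move=> E mE; rewrite charge_pos_opp0.
- move=> m mw E mE; apply/eqP; rewrite eq_le measure_ge0 andbT.
  by rewrite -(@charge_pos_opp0 w E w0) mw.
Qed.

Lemma yosida_hewitt_pure w : pure_at_origin w -> yosida_hewitt w (fun=> 0%R) w.
Proof.
move=> [baw ppw _ _]; split => //.
- by apply/Lfun1_integrable; exact: integrable0.
- exact: positive_pure_pure.
- by move=> E mE; rewrite integral0_eq ?add0e.
Qed.

(** The measure with density g on A and 0 elsewhere is countably additive and stays below the
    positive part of [v]: its value at E is that of [v] at the intersection of E and A, a subset of
    E. Purity makes it zero, and a nonnegative function with integral 0 vanishes a.e. *)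
Lemma pure_density_ae0 (v : set (lebT R) -> \bar R) (A : set (lebT R)) (g : lebT R -> R) :
  measurable A -> measurable_fun setT g -> (forall t, A t -> (0 <= g t)%R) ->
  (forall E, measurable E -> E `<=` A -> \int[leb01 R]_(t in E) (g t)%:E = v E) ->
  positive_pure (charge_pos v) ->
  \forall t \ae leb01 R, A t -> g t = 0%R.
Proof.
move=> mA mg g0 vE [_ vp].
have mh : measurable_fun setT ((EFin \o g) \_ A).
  by apply/(measurable_restrictT _ mA); apply: measurable_funTS; exact/measurable_EFinP.
have h0 t : 0 <= ((EFin \o g) \_ A) t.
  by rewrite patchE; case: ifPn => // /set_mem /g0; rewrite /= lee_fin.
have [m mE] := measure_of_density (leb01 R) mh h0.
have : m setT = 0.
  apply: vp => // E mE'; rewrite mE -integral_mkcondr vE;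
    [|exact: measurableI|exact: subIsetr].
  by apply: ereal_sup_ubound; exists (E `&` A) => //; split;
    [exact: measurableI|exact: subIsetl].
rewrite mE.
have -> : \int[leb01 R]_t ((EFin \o g) \_ A) t = \int[leb01 R]_t `|((EFin \o g) \_ A) t|.
  by apply: eq_integral => t _; rewrite gee0_abs.
move=> /(ae_eq_integral_abs _ measurableT mh); apply: filterS => t /= /(_ I).
by rewrite patchE => + At; rewrite mem_set// => -[].
Qed.

Lemma ae_leb01_pos : \forall t \ae leb01 R, (0 < (t : R) <= 1)%R.
Proof.
have mI := @measurable_leb_itv R `]0%R, 1%R].
exists (~` (`]0%R, 1%R]%classic : set R)); split.
- exact: measurableC.
- apply: (leb01_null (measurableC mI)) => //; last exact: measurableC.
  move=> t [/=]; rewrite !in_itv/= => /negP + /andP[t0 t1].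
  by rewrite t1 andbT -leNgt => t0'; apply/le_anti; rewrite t0 t0'.
- by move=> t /=; rewrite in_itv/=.
Qed.

(* On sets that stay away from the origin the charge [w] vanishes, so there the
   purity of [zeta] forces the density [z] to vanish. *)
Lemma yosida_hewitt_unique w z zeta : pure_at_origin w -> yosida_hewitt w z zeta ->
  (\forall t \ae leb01 R, z t = 0%R) /\
  forall E, measurable E -> zeta E = w E.
Proof.
move=> [[w_dom _] [w_ge0 _] w_near w1] [/Lfun1_integrable intz _ [zeta_pos zeta_neg] wE].
have mz : measurable_fun [set: lebT R] (z : lebT R -> R).
  by apply/measurable_EFinP; exact: measurable_int intz.
(* ]0, e'[ already carries the full mass 1 of [w], so a set disjoint from it inside [0, 1] carries
   none. *)
have w_far (e : R) (E : set (lebT R)) : (0 < e)%R -> measurable E ->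
    E `<=` (`[e, 1%R]%classic : set R) -> w E = 0.
  move=> e0 mE Ee; pose e' := Num.min e 1%R.
  have e'0 : (0 < e')%R by rewrite lt_min e0 ltr01.
  have m0e := @measurable_leb_itv R `]0%R, e'[.
  apply/eqP; rewrite eq_le w_ge0// andbT.
  have : w ((`]0%R, e'[%classic : set R) `|` E) <= w (`[0%R, 1%R]%classic : set R).
    apply: le_additive_charge => //; [exact: measurableU|exact: measurable01|].
    move=> t [|/Ee] /=; rewrite !in_itv/=.
      by move=> /andP[/ltW-> /ltW te]; rewrite (le_trans te)// ge_min lexx orbT.
    by move=> /andP[et ->]; rewrite (le_trans (ltW e0)).
  rewrite additive_chargeU//; last first.
    apply/seteqP; split => // t [/=]; rewrite in_itv/= => /andP[_ te] /Ee/=.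
    rewrite in_itv/= => /andP[et _]; have := lt_le_trans te (le_trans _ et).
    by rewrite ltxx ge_min lexx => /(_ isT).
  have wfin : w E \is a fin_num by exact: fin_num_measure.
  by rewrite w_near// w1 -(fineK wfin) -EFinD !lee_fin gerDl.
have zetaE (e : R) (E : set (lebT R)) : (0 < e)%R -> measurable E ->
    E `<=` (`[e, 1%R]%classic : set R) -> zeta E = - \int[leb01 R]_(t in E) (z t)%:E.
  move=> e0 mE Ee; have := wE E mE; rewrite (w_far e)// => /esym.
  have zfin : \int[leb01 R]_(t in E) (z t)%:E \is a fin_num.
    by apply: integrable_fin_num => //; exact: integrableS intz.
  have zetafin : zeta E \is a fin_num by exact: fin_num_measure.
  by rewrite -(fineK zfin) -(fineK zetafin) -EFinD => -[] /eqP;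
    rewrite addrC addr_eq0 => /eqP ->.
(* Signs are separated: where z < 0 the charge [zeta] is the measure - z dt, which purity of its
   positive part forces to vanish; where z > 0 the same applies to the opposite charge. *)
have far (e : R) : (0 < e)%R ->
    \forall t \ae leb01 R, (e <= (t : R) <= 1)%R -> z t = 0%R.
  move=> e0; have me := @measurable_leb_itv R `[e, 1%R].
  have mlt : measurable ([set t | (z t < 0)%R] : set (lebT R)).
    by rewrite -[X in measurable X]setTI; apply: measurable_fun_ltr => //;
      exact: measurable_cst.
  have mgt : measurable ([set t | (0 < z t)%R] : set (lebT R)).
    by rewrite -[X in measurable X]setTI; apply: measurable_fun_ltr => //;
      exact: measurable_cst.
  have neg : \forall t \ae leb01 R,
      ((`[e, 1%R]%classic : set R) `&` [set t | (z t < 0)%R]) t -> (- z t = 0)%R.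
    apply: (@pure_density_ae0 zeta _ (fun t => - z t)%R).
    - exact: measurableI.
    - exact: measurable_funN.
    - by move=> t [_ /= zt]; rewrite oppr_ge0 ltW.
    - move=> E mE EA; rewrite (zetaE e)//; last by move=> t /EA[].
      have intzE : (leb01 R).-integrable E (EFin \o z) by exact: integrableS intz.
      under eq_integral do rewrite EFinN.
      by rewrite integralN//; exact: integrable_add_def intzE.
    - exact: zeta_pos.
  have pos : \forall t \ae leb01 R,
      ((`[e, 1%R]%classic : set R) `&` [set t | (0 < z t)%R]) t -> (z t = 0)%R.
    apply: (@pure_density_ae0 (fun E => - zeta E) _ z).
    - exact: measurableI.
    - exact: mz.
    - by move=> t [_ /= zt]; rewrite ltW.
    - by move=> E mE EA; rewrite (zetaE e) ?oppeK//; last by move=> t /EA[].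
    - exact: zeta_neg.
  move: neg pos; apply: (@filterS2 _ (almost_everywhere (leb01 R))) => t h1 h2 te;
    apply/eqP.
  have [zt|zt|//] := ltgtP (z t) 0%R.
  - have /eqP : (- z t = 0)%R by apply: h1; split => //=; rewrite in_itv.
    by rewrite oppr_eq0 lt_eqF.
  - have /eqP : (z t = 0)%R by apply: h2; split => //=; rewrite in_itv.
    by rewrite gt_eqF.
have z0 : \forall t \ae leb01 R, z t = 0%R.
  (* The intervals [1/(k + 1), 1] exhaust ]0, 1], so only countably many null sets are discarded. *)
  have h : \forall t \ae leb01 R, forall k : nat,
    (k.+1%:R^-1 <= (t : R) <= 1)%R -> z t = 0%R.
    by apply/ae_foralln => k; apply: far; rewrite invr_gt0.
  move: h ae_leb01_pos;
    apply: (@filterS2 _ (almost_everywhere (leb01 R))) => t h /andP[t0 t1].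
  have tV0 : (0 <= t^-1)%R by rewrite invr_ge0 ltW.
  apply: (h (Num.Def.trunc (t^-1)%R)); rewrite t1 andbT invf_ple ?posrE//.
  by have /andP[_ /ltW] := trunc_itv tV0.
split => // E mE; rewrite wE// (ae_eq_integral (cst 0)) ?integral0 ?add0e//.
- by apply/measurable_EFinP; exact: measurable_funTS.
- by move: z0; apply: (@filterS _ (almost_everywhere (leb01 R))) => t /= -> _.
Qed.

End yosida_hewitt.

(** * The truncated problem *)

Section antiderivative.
Context (R : realType) (a K : R) (G : lebT R -> R).
Hypotheses (a1 : a < 1) (K0 : 0 <= K) (mG : measurable_fun setT G).
Hypothesis G0K : forall t, 0 <= G t <= K.

Let J : set (lebT R) := (`[a, 1]%classic : set R).

Lemma leb_itv1 : leb J = (1 - a)%:E.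
Proof.
by rewrite -[LHS]/(lebesgue_measure J) lebesgue_measure_itv/= lte_fin a1 -EFinD.
Qed.

Let mJ : measurable J. Proof. exact: measurable_leb_itv. Qed.

Let leb_lty (E : set (lebT R)) : measurable E -> E `<=` J -> (leb E < +oo)%E.
Proof.
move=> mE EJ; apply: (@le_lt_trans _ _ (leb J)); last by rewrite leb_itv1 ltry.
by apply: le_measure => //; rewrite inE.
Qed.

Let intG (E : set (lebT R)) : measurable E -> E `<=` J -> leb.-integrable E (EFin \o G).
Proof.
move=> mE EJ; apply: (@integrable_bounded _ _ _ leb E G K mE (leb_lty mE EJ)).
  exact: measurable_funTS.
by move=> t _; have /andP[G0 GK] := G0K t; rewrite ger0_norm.
Qed.

(** Intersecting with [J] keeps every domain inside a set of finite measure, so that [H] is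
    nondecreasing on the whole line; measurability of the antiderivative comes from this
    monotonicity. *)
Let H (t : R) : R := \int[leb]_(s in (`[a, t]%classic : set R) `&` J) G s.

Let mat t : measurable ((`[a, t]%classic : set R) `&` J : set (lebT R)).
Proof. by apply: measurableI => //; exact: measurable_leb_itv. Qed.

Let H_nd : {homo H : s t / s <= t}.
Proof.
move=> s t st; apply: fine_le.
- by apply: integrable_fin_num => //; apply: intG => //; exact: subIsetr.
- by apply: integrable_fin_num => //; apply: intG => //; exact: subIsetr.
have mGt : measurable_fun (((`[a, t]%classic : set R) `&` J) : set (lebT R)) (EFin \o G).
  by apply/measurable_EFinP; exact: measurable_funTS.
have mas := mat s; have mat' := mat t.
apply: (ge0_subset_integral _ mas mat' mGt).
  by move=> u _; rewrite /= lee_fin; have /andP[] := G0K u.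
by move=> u [/=]; rewrite in_itv/= => /andP[au us] Ju; split => //=;
  rewrite in_itv/= au (le_trans us).
Qed.

Let HE (t : R) : a <= t <= 1 -> \int[leb]_(s in (`[a, t]%classic : set R)) G s = H t.
Proof.
move=> /andP[_ t1]; rewrite /H setIidl// => u; rewrite /J/= !in_itv/= => /andP[-> ut].
exact: le_trans t1.
Qed.

Lemma antiderivative_ge0 (t : R) : 0 <= \int[leb]_(s in (`[a, t]%classic : set R)) G s.
Proof. by apply: Rintegral_ge0 => s _; have /andP[] := G0K s. Qed.

Lemma antiderivative_le (t : R) : a <= t <= 1 ->
  \int[leb]_(s in (`[a, t]%classic : set R)) G s <= K * (1 - a).
Proof.
move=> t01; rewrite HE//.
have fin := mat t; apply: le_trans (Rintegral_le_cst fin _ (intG fin _) (fun s _ =>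
  proj2 (andP (G0K s)))) _.
- by apply: leb_lty => //; exact: subIsetr.
- exact: subIsetr.
rewrite ler_wpM2l// -lee_fin fineK; last first.
  by rewrite ge0_fin_numE ?measure_ge0//; apply: leb_lty => //; exact: subIsetr.
by rewrite -leb_itv1; apply: le_measure; rewrite ?inE//; exact: subIsetr.
Qed.

Lemma measurable_antiderivative : measurable_fun J
  ((fun t => \int[leb]_(s in (`[a, t]%classic : set R)) G s) : lebT R -> R).
Proof.
apply: (@eq_measurable_fun _ _ _ _ _ (H : lebT R -> R)).
  by move=> t /set_mem; rewrite /J/= in_itv/= => t01; rewrite HE.
by apply: (measurable_fun_leb (measurable_itv `[a, 1]));
  apply: nondecreasing_measurable => //; exact: H_nd.
Qed.

Lemma integrable_antiderivative : leb.-integrable J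
  (EFin \o (fun t => \int[leb]_(s in (`[a, t]%classic : set R)) G s)).
Proof.
have Jlty := leb_lty mJ (@subset_refl _ J).
apply: (@integrable_bounded _ _ _ leb J _ (K * (1 - a)) mJ Jlty measurable_antiderivative).
move=> t; rewrite /J/= in_itv/= => t01.
by rewrite ger0_norm ?antiderivative_ge0//; exact: antiderivative_le.
Qed.

(* The antiderivative is nondecreasing and [K]-Lipschitz: it vanishes on [a, 1[
   by monotonicity, and at 1 by continuity. *)
Lemma antiderivative_eq0 :
  \int[leb]_(t in (`[a, 1]%classic : set R)) \int[leb]_(s in (`[a,
    t]%classic : set R)) G s = 0 ->
  \forall t \ae lebI a 1, G t = 0.
Proof.
move=> int0.
pose h t := \int[leb]_(s in (`[a, t]%classic : set R)) G s.
have h_ge0 t : 0 <= h t by exact: antiderivative_ge0.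
have H0 t : a <= t < 1 -> H t = 0.
  move=> /andP[at1 t1]; have t01 : a <= t <= 1 by rewrite at1 ltW.
  apply/le_anti/andP; split; last by rewrite -(HE t01); exact: h_ge0.
  pose T1 : set (lebT R) := (`[t, 1]%classic : set R).
  pose T0 : set (lebT R) := (`[a, t[%classic : set R).
  have mT1 : measurable T1 by exact: measurable_leb_itv.
  have mT0 : measurable T0 by exact: measurable_leb_itv.
  have JT : J = T0 `|` T1.
    apply/seteqP; split => s; rewrite /J/T0/T1/= !in_itv/=.
      by move=> /andP[-> ->]; case: (ltP s t) => _; [left|right].
    by move=> [/andP[-> /ltW st]|/andP[ts ->]];
      rewrite ?(le_trans st (ltW t1)) ?(le_trans at1 ts).
  have T1J : T1 `<=` J by rewrite JT; exact: subsetUr.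
  have T0J : T0 `<=` J by rewrite JT; exact: subsetUl.
  have lebT1 : leb T1 = (1 - t)%:E.
    by rewrite -[LHS]/(lebesgue_measure T1) lebesgue_measure_itv/= lte_fin t1 -EFinD.
  have inth : leb.-integrable J (EFin \o h) by exact: integrable_antiderivative.
  have inth1 : leb.-integrable T1 (EFin \o h) by exact: integrableS inth.
  (* On [t, 1] monotonicity bounds [h] below by [H t], so the zero integral dominates [H t] times
     the positive length 1 - t. *)
  have : H t * fine (leb T1) <= 0.
    rewrite -(Rintegral_cst leb mT1) -[leRHS]int0.
    rewrite -[X in _ <= \int[_]_(_ in X) _]/J JT Rintegral_setU//; last 2 first.
    - by rewrite -JT.
    - apply/disj_setPS => s [];
      rewrite /T0/T1/= !in_itv/= => /andP[_ st] /andP[/le_lt_trans/(_ st)].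
      by rewrite ltxx.
    rewrite -[leLHS]add0r; apply: lerD; first by apply: Rintegral_ge0 => s _; exact: h_ge0.
    apply: le_Rintegral => //.
      apply: (@integrable_bounded _ _ _ leb T1 _ `|H t| mT1 (leb_lty mT1 T1J)) => //.
    move=> s; rewrite /T1/= in_itv/= => /andP[ts s1].
    by rewrite /h HE ?s1 ?(le_trans at1)//; exact: H_nd.
  by rewrite lebT1/= pmulr_lle0// subr_gt0.
have J1 : (`[a, 1]%classic : set R) `&` J = J by exact: setIid.
have H1 : H 1 <= 0.
  apply/ler_addgt0Pr => e e0; rewrite add0r.
  (* [G] is at most K, so the piece ]t, 1] contributes at most K e / (K + 1) <= e; adding 1 keeps
     the denominator positive when K = 0. *)
  pose t := Num.max a (1 - e / (K + 1)).
  have K1 : 0 < K + 1 by rewrite ltr_wpDl.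
  have at1 : a <= t by rewrite le_max lexx.
  have t1 : t < 1 by rewrite gt_max a1/= ltrBlDr ltrDl divr_gt0.
  have t01 : a <= t <= 1 by rewrite at1 ltW.
  pose T1 : set (lebT R) := (`]t, 1]%classic : set R).
  pose T0 : set (lebT R) := (`[a, t]%classic : set R).
  have mT1 : measurable T1 by exact: measurable_leb_itv.
  have mT0 : measurable T0 by exact: measurable_leb_itv.
  have JT : J = T0 `|` T1.
    apply/seteqP; split => s; rewrite /J/T0/T1/= !in_itv/=.
      by move=> /andP[-> ->]; case: (leP s t) => _; [left|right].
    by move=> [/andP[-> st]|/andP[/ltW ts ->]];
      rewrite ?(le_trans st (ltW t1)) ?(le_trans at1 ts).
  have T1J : T1 `<=` J by rewrite JT; exact: subsetUr.
  have lebT1 : leb T1 = (1 - t)%:E.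
    by rewrite -[LHS]/(lebesgue_measure T1) lebesgue_measure_itv/= lte_fin t1 -EFinD.
  rewrite /H J1 JT Rintegral_setU//; last 2 first.
  - by rewrite -JT; exact: intG.
  - apply/disj_setPS => s [];
    rewrite /T0/T1/= !in_itv/= => /andP[_ st] /andP[/lt_le_trans/(_ st)].
    by rewrite ltxx.
  rewrite [X in X + _](HE t01) H0 ?at1// add0r.
  apply: le_trans (Rintegral_le_cst mT1 (leb_lty mT1 T1J) (intG mT1 T1J) (fun s _ =>
    proj2 (andP (G0K s)))) _.
  rewrite [X in fine X]lebT1/=.
  have te : 1 - t <= e / (K + 1) by rewrite lerBlDl -lerBlDr le_max lexx orbT.
  apply: (le_trans (ler_wpM2l K0 te)).
  by rewrite mulrA ler_pdivrMr// mulrC ler_wpM2l ?(ltW e0)// lerDl.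
have {}H1 : (\int[leb]_(t in J) `|(G t)%:E| = 0)%E.
  under eq_integral do rewrite gee0_abs ?lee_fin ?(proj1 (andP (G0K _)))//.
  have fin : (\int[leb]_(t in J) (G t)%:E)%E \is a fin_num.
    by apply: integrable_fin_num => //; exact: intG.
  rewrite -(fineK fin); congr EFin; apply/le_anti/andP; split.
    by move: H1; rewrite /H J1.
  exact: (@antiderivative_ge0 1).
apply: ae_lebIP.
have mGJ : measurable_fun J (EFin \o G) by apply/measurable_EFinP; exact: measurable_funTS.
move: H1 => /(ae_eq_integral_abs leb mJ mGJ).
apply: (@filterS _ (almost_everywhere leb)) => t /= + t01.
by rewrite /J/= in_itv/= => /(_ t01)[].
Qed.

End antiderivative.

Section truncated_problem.
Context (R : realType) (a : R).
Hypotheses (a0 : 0 < a) (a1 : a < 1).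

Let J : set (lebT R) := (`[a, 1]%classic : set R).
Let mJ : measurable J. Proof. exact: measurable_leb_itv. Qed.
Let Jfin : (leb J < +oo)%E. Proof. by rewrite leb_itv1// ltry. Qed.

Lemma Rintegral_leb_id (t : R) : a <= t ->
  \int[leb]_(s in (`[a, t]%classic : set (lebT R))) (s : R) = t ^+ 2 / 2 - a ^+ 2 / 2.
Proof.
move=> at1.
have dF s (_ : a <= s <= t) : is_derive s 1 (fun s : R => s ^+ 2 / 2) s.
  have d2 : is_derive s 1 (fun s : R => s ^+ 2) (2 * s).
    by apply: (is_derive_eq (is_deriveM (is_derive_id s 1) (is_derive_id s 1)));
      rewrite /GRing.scale/= mulr1 mulr2n mulrDl mul1r.
  apply: (is_derive_eq (is_deriveM d2 (is_derive_cst (2^-1 : R) s 1))).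
  by rewrite scaler0 add0r /GRing.scale/= mulrA mulVf// mul1r.
have cf s (_ : a <= s <= t) : {for s, continuous (@id R)} by exact: cvg_id.
by rewrite /Rintegral (integral_leb_FTC at1 dF cf).
Qed.

Lemma Rintegral_leb_cst (t c : R) : a <= t ->
  \int[leb]_(s in (`[a, t]%classic : set (lebT R))) c = c * (t - a).
Proof.
move=> at1; rewrite Rintegral_cst; last exact: measurable_leb_itv.
congr (_ * _).
have := lebI_itv (lexx a) at1 (lexx t); rewrite lebIE setIid => h.
by rewrite [X in fine X]h.
Qed.

Let mid : measurable_fun setT (fun t : lebT R => t : R).
Proof. by apply: (measurable_fun_leb measurableT). Qed.

Let intid : leb.-integrable J (EFin \o (fun t : lebT R => t : R)).
Proof.
apply: (@integrable_bounded _ _ _ leb J _ 1 mJ Jfin (measurable_funTS mid)).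
move=> t; rewrite /J/= in_itv/= => /andP[at1 t1].
by rewrite ger0_norm// (le_trans (ltW a0)).
Qed.

Lemma lebI_ae (P : R -> Prop) : (\forall t \ae lebI a 1, P t) ->
  \forall t \ae leb, a <= (t : R) <= 1 -> P t.
Proof.
move=> [N [mN N0 PN]]; exists (N `&` J); split; first exact: measurableI.
- exact: N0.
- move=> t /= /not_implyP[t01 nP]; split; first exact: PN.
  by rewrite /J/= in_itv.
Qed.

Lemma eq_Rintegral_ae (f g : lebT R -> R) (t : R) : t <= 1 ->
  measurable_fun setT f -> measurable_fun setT g ->
  (\forall s \ae lebI a 1, f s = g s) ->
  \int[leb]_(s in (`[a, t]%classic : set R)) f s =
  \int[leb]_(s in (`[a, t]%classic : set R)) g s.
Proof.
move=> t1 mf mg /lebI_ae fg; congr fine; apply: ae_eq_integral.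
- exact: measurable_leb_itv.
- by apply: measurable_funTS; exact/measurable_EFinP.
- by apply: measurable_funTS; exact/measurable_EFinP.
- move: fg; apply: (@filterS _ (almost_everywhere leb)) => s fg;
  rewrite /= in_itv/= => /andP[as_ st].
  by rewrite fg// as_ (le_trans st).
Qed.

Lemma ae_lebI_itv : \forall t \ae lebI a 1, a <= (t : R) <= 1.
Proof. exact: nearW_lebI. Qed.

Lemma admissible_id : admissible a (fun t : R => t ^+ 2 / 2) (fun t : R => t).
Proof.
split.
- rewrite inE/=; apply/andP; split; rewrite inE/=; first exact: mid.
  rewrite /finite_norm (@le_lt_trans _ _ 1%:E)// ?ltry//.
  apply: Lnorm_infty_lebI_le => //; apply: nearW_lebI => t /andP[at1 t1].
  by rewrite ger0_norm// (le_trans (ltW a0)).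
- split; first exact: intid.
  by move=> t /andP[at1 t1]; rewrite Rintegral_leb_id// addrC subrK.
- by apply: nearW_lebI => t _; rewrite -expr2 subrr.
- by [].
Qed.

(** For a competitor, h = t ^ 2 / 2 - x' starts at 0 and has derivative t - u' >= 0, so the costs
    differ by the integral of h >= 0. Equal costs force this integral, hence t - u', to vanish. *)
Lemma unique_minimizer_id : unique_minimizer a (fun t : R => t ^+ 2 / 2) (fun t : R => t).
Proof.
split; first exact: admissible_id.
move=> x' u' [/andP[]]; rewrite inE/= => mu'; rewrite inE/= => u'fin [intu' x'E] u'g x'a.
have [K K0 u'K] : exists2 K, 0 <= K & \forall t \ae lebI a 1, `|u' t| <= K.
  have Nfin : ('N[lebI a 1]_+oo[EFin \o u'])%E \is a fin_num.
    by rewrite ge0_fin_numE ?Lnorm_ge0.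
  exists (fine ('N[lebI a 1]_+oo[EFin \o u'])%E); first by rewrite fine_ge0// Lnorm_ge0.
  by apply: Lnorm_infty_ae => //; rewrite fineK.
(* This is t - u' clipped to [0, 1 + K]. It is unchanged a.e., because t u' <= t ^ 2 with t > 0
   gives u' <= t, while t <= 1 and u' >= - K; the clipping makes the bounds hold at every point, as
   [antiderivative_eq0] asks. *)
pose G (t : lebT R) : R := Num.min (Num.max ((t : R) - u' t) 0) (1 + K).
have mG : measurable_fun setT G.
  apply: measurable_minr; last exact: measurable_cst.
  apply: measurable_maxr; last exact: measurable_cst.
  exact: measurable_funB.
have K10 : 0 <= 1 + K by rewrite addr_ge0.
have G0K t : 0 <= G t <= 1 + K.
  by rewrite /G le_min le_max lexx orbT K10 ge_min lexx orbT.
have GE : \forall t \ae lebI a 1, G t = (t : R) - u' t.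
  move: u'K u'g ae_lebI_itv.
  apply: (@filterS3 _ (almost_everywhere (lebI a 1))) => t u'K u'g /andP[at1 t1].
  have t0 : 0 < (t : R) by exact: lt_le_trans at1.
  have u't : u' t <= (t : R).
    by rewrite -(ler_pM2l t0) -subr_le0 -expr2.
  rewrite /G max_l ?subr_ge0// min_l//.
  by move: u'K; rewrite ler_norml => /andP[h _]; rewrite lerD// lerNl.
pose h t := \int[leb]_(s in (`[a, t]%classic : set R)) G s.
have mDu : measurable_fun setT (fun t : lebT R => (t : R) - u' t) by exact: measurable_funB.
have hE t : a <= t <= 1 -> h t = t ^+ 2 / 2 - x' t.
  move=> t01; have /andP[at1 t1] := t01.
  rewrite /h (eq_Rintegral_ae t1 mG mDu GE).
  have mt := @measurable_leb_itv R `[a, t].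
  have tJ : (`[a, t]%classic : set R) `<=` J.
    by move=> s; rewrite /J/= !in_itv/= => /andP[-> st]; exact: le_trans t1.
  rewrite RintegralB//; last 2 first.
  - exact: integrableS intid.
  - exact: integrableS intu'.
  by rewrite Rintegral_leb_id// (x'E t t01) x'a opprD addrA.
have inth : leb.-integrable J (EFin \o h)
  by exact: (integrable_antiderivative a1 K10 mG G0K).
have costE : cost a x' = cost a (fun t => t ^+ 2 / 2) + \int[leb]_(t in J) h t.
  have mq : measurable_fun setT (fun t : lebT R => (t : R) ^+ 2 / 2).
    exact: (measurable_funM (measurable_funM mid mid) (measurable_cst _)).
  have intq : leb.-integrable J (EFin \o (fun t : lebT R => (t : R) ^+ 2 / 2)).
    apply: (@integrable_bounded _ _ _ leb J _ 1 mJ Jfin (measurable_funTS mq)).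
    move=> t; rewrite /J/= in_itv/= => /andP[at1 t1].
    have t0 : 0 <= t by exact: le_trans (ltW a0) at1.
    rewrite ger0_norm; last by rewrite divr_ge0 ?sqr_ge0.
    have : t ^+ 2 <= 1 by rewrite expr_le1.
    lra.
  rewrite /cost -[RHS]opprK opprD opprK -(RintegralB mJ intq inth).
  congr (- _); apply: eq_Rintegral => t; rewrite inE/= in_itv/= => t01.
  by rewrite hE// subKr.
have h_ge0 t : 0 <= h t by apply: Rintegral_ge0 => s _; have /andP[] := G0K s.
rewrite costE lerDl; split; first by apply: Rintegral_ge0 => t _; exact: h_ge0.
rewrite -[RHS]addr0 => /addrI h0.
have G0 := antiderivative_eq0 a1 K10 mG G0K h0.
split.
  move=> t t01; have /andP[at1 t1] := t01.
  apply/eqP; rewrite eq_sym -subr_eq0 -hE// /h (eq_Rintegral_ae t1 mG _ G0)//.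
  by rewrite Rintegral_cst ?mul0r//; exact: measurable_leb_itv.
move: G0 GE; apply: (@filterS2 _ (almost_everywhere (lebI a 1))) => t -> /esym/eqP.
by rewrite subr_eq0 => /eqP.
Qed.

End truncated_problem.

Section multipliers.
Context (R : realType) (n : nat).
Hypothesis n2 : (2 <= n)%N.

Let a : R := n%:R^-1.
Let a01 : 0 < a < 1. Proof. exact: invn_itv. Qed.
Let a0 : 0 < a. Proof. by case/andP: a01. Qed.
Let a1 : a < 1. Proof. by case/andP: a01. Qed.

Let integrable_cst (c : R) :
  leb.-integrable ((`[a, 1]%classic : set R) : set (lebT R)) (EFin \o (fun=> c)).
Proof.
have mJ := @measurable_leb_itv R `[a, 1].
apply: (@integrable_bounded _ _ _ leb _ _ `|c| mJ) => //.
by have := leb_itv1 a1 => /= ->; rewrite ltry.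
Qed.

Lemma regular_multipliers_truncated :
  regular_multipliers a (fun t : R => t) (lambda0_ R n) (lambda_ R n) (z_ R n).
Proof.
have l0 := lambda0_gt0 R n2.
have lE t : a <= t <= 1 -> lambda_ R n t = lambda0_ R n * (t - 1).
  by move=> t01; rewrite /lambda_ t01.
split.
- exact: ltW.
- split; last by rewrite lE ?lexx ?(ltW a1)// subrr mulr0.
  split; first exact: integrable_cst.
  move=> t /[dup] t01 /andP[at1 t1].
  rewrite (Rintegral_leb_cst _ at1) !lE ?lexx ?(ltW a1) ?t01//; ring.
- rewrite inE/=; apply/andP; split; rewrite inE/=; first exact: measurable_z_.
  by rewrite /finite_norm Lnorm1_z_lebI// ltry.
- apply: nearW_lebI => t t01; split; first exact: z__ge0.
  by rewrite -expr2 subrr mulr0.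
- apply: nearW_lebI => t /[dup] t01 /andP[at1 t1]; rewrite lE// /z_ t01.
  have t0 : 0 < t by exact: lt_le_trans at1.
  by field; rewrite gt_eqF.
Qed.

(** The adjoint equation with l(1) = 0 gives l = l0 (t - 1), and stationarity divided by t gives z =
    (l0 / lambda0) z_n a.e. The normalization l0 + (l0 / lambda0) (1 - lambda0) = 1 then reads l0 /
    lambda0 = 1. *)
Lemma regular_multipliers_unique (l0 : R) (l z : R -> R) :
  regular_multipliers a (fun t : R => t) l0 l z ->
  (l0%:E + 'N[lebI a 1]_1[EFin \o z] = 1)%E ->
  [/\ l0 = lambda0_ R n, forall t, a <= t <= 1 -> l t = lambda_ R n t &
      \forall t \ae lebI a 1, z t = z_ R n t].
Proof.
move=> [l00 [[_ lE] l1] zL1 zpos stat] norm1.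
have L0 := lambda0_gt0 R n2.
have lE' t : a <= t <= 1 -> l t = l0 * (t - 1).
  move=> /[dup] t01 /andP[at1 t1].
  have := lE t t01; rewrite (Rintegral_leb_cst _ at1).
  have := lE 1 _; rewrite (Rintegral_leb_cst _ (ltW a1)) l1 (ltW a1) lexx => /(_ isT).
  lra.
have zE : \forall t \ae lebI a 1, z t = l0 / lambda0_ R n * z_ R n t.
  move: stat (ae_lebI_itv a); apply: (@filterS2 _ (almost_everywhere (lebI a 1))).
  move=> t + /[dup] t01 /andP[at1 t1]; rewrite lE'// /z_ t01 => tz.
  have t0 : 0 < t by exact: lt_le_trans at1.
  have -> : z t = t^-1 * (l0 * (1 - t)).
    apply: (mulfI (lt0r_neq0 t0)); rewrite mulVKf ?gt_eqF//; lra.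
  by field; rewrite !gt_eqF.
have N1 : ('N[lebI a 1]_1[EFin \o z] = (l0 / lambda0_ R n * (1 - lambda0_ R n))%:E)%E.
  have c0 : 0 <= l0 / lambda0_ R n by rewrite divr_ge0// ltW.
  have /Lfun1_integrable intz := zL1; have mz := measurable_int _ intz.
  have mz' := measurableT_comp (@abse_measurable R setT) mz.
  have mzn : measurable_fun setT (EFin \o (z_ R n : lebT R -> R)).
    exact/measurable_EFinP/measurable_z_.
  have mzn' := measurableT_comp (@abse_measurable R setT) mzn.
  rewrite EFinM -(Lnorm1_z_lebI R n2) !Lnorm1.
  rewrite -(ge0_integralZl_EFin (lebI a 1) measurableT (fun x _ => abse_ge0 _) mzn' c0).
  have mcz := emeasurable_funM (measurable_cst (l0 / lambda0_ R n)%:E) mzn'.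
  apply: (@ae_eq_integral _ _ _ (lebI a 1) setT _ _ measurableT mz' mcz).
  move: zE; apply: (@filterS _ (almost_everywhere (lebI a 1))) => t zt _.
  by rewrite /= zt normrM (ger0_norm c0).
have l0E : l0 = lambda0_ R n.
  move: norm1; rewrite N1 -EFinD => -[] h.
  have : l0 / lambda0_ R n = 1.
    rewrite -h; field; exact: lt0r_neq0.
  by move=> /divr1_eq.
split => //.
- by move=> t t01; rewrite lE'// /lambda_ t01 l0E.
- move: zE; apply: (@filterS _ (almost_everywhere (lebI a 1))) => t ->.
  by rewrite l0E divff ?mul1r// lt0r_neq0.
Qed.

End multipliers.

(** * Generalized limits *)

Section generalized_limits.
Context (R : realType).
Implicit Types w zeta : {additive_charge set (lebT R) -> \bar R}.

Lemma lambda0_le1 n : (2 <= n)%N -> lambda0_ R n <= 1.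
Proof.
by move=> n2; rewrite -subr_ge0 -lee_fin -(mu01 R n2) measure_ge0.
Qed.

Lemma normr_lambda_le n (t : R) : (2 <= n)%N -> 0 <= t <= 1 ->
  `|lambda_ R n t| <= lambda0_ R n.
Proof.
move=> n2 /andP[t0 t1]; have l0 := lambda0_gt0 R n2; rewrite /lambda_.
case: ifPn => _; last by rewrite normr0 ltW.
by rewrite normrM gtr0_norm// ler_piMr ?(ltW l0)// ler_norml; apply/andP; split; lra.
Qed.

Lemma lambda_cvg0 (t : R) : 0 <= t <= 1 -> (fun n => lambda_ R n t) @ \oo --> (0 : R).
Proof.
move=> t01; apply/norm_cvg0P; apply: squeeze_cvgr (cvg_cst 0) (@lambda0_cvg0 R).
near=> n; rewrite normr_ge0/= normr_lambda_le//; near: n; exact: nbhs_infty_ge.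
Unshelve. all: by end_near. Qed.

(** Both kinds of generalized limit end here. Concentration is at ts = 0 from the right, with alpha
    = 0, so the condition on t < ts is void. *)
Lemma degenerate_generalized_limit w (lambda beta : R -> R) (lambda0 : R)
    (z : R -> R) zeta : pure_at_origin w ->
  (forall t, 0 <= t <= 1 -> lambda t = 0) ->
  (forall t, 0 <= t <= 1 -> beta t = 0) -> lambda0 = 0 ->
  yosida_hewitt w z zeta ->
  [/\ degenerate lambda beta lambda0 z zeta,
      trivial_multipliers w lambda beta lambda0 z zeta & pure_at_origin w].
Proof.
move=> pw lambda_0 beta_0 lambda0_0 /(yosida_hewitt_unique pw)[z0 zetaE].
have [bz pz near_z _] := pure_at_origin_ext (fun E mE => esym (zetaE E mE)) pw.
split => //; last by split=> // t t01; rewrite lambda_0// beta_0.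
split=> //; exists 0, 0; split.
- by rewrite lexx ler01.
- by move=> t /andP[t0 _] /(le_lt_trans t0); rewrite ltxx.
- by move=> t t01 _; rewrite lambda_0// beta_0// oppr0.
- by [].
- by left => e e0; rewrite add0r; exact: near_z.
Qed.

(** From index 2 on, [lambda0_] and [lambda_] are bounded by 1, which allows [blim_cvg] to replace
    their Banach limits by ordinary ones. *)
Lemma banach_generalized_limit_degenerate (B : (nat -> R) -> R) w :
  banach_limit B -> banach_charge B w ->
  banach_generalized_limit B w (fun=> 0) (fun=> 0) 0 (fun=> 0) w /\
  forall (lambda beta : R -> R) (lambda0 : R) (z : R -> R) zeta,
    banach_generalized_limit B w lambda beta lambda0 z zeta ->
    [/\ degenerate lambda beta lambda0 z zeta,
        trivial_multipliers w lambda beta lambda0 z zeta &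
        pure_at_origin w].
Proof.
move=> BL wB; have pw := banach_charge_pure BL wB.
have lambda0B : blim B (lambda0_ R) = 0.
  apply: (blim_cvg BL); last exact: lambda0_cvg0.
  apply: (@bounded_funI _ _ 1) => k.
  by rewrite ger0_norm ?lambda0_le1// ltW// lambda0_gt0.
have lambdaB t : 0 <= t <= 1 -> blim B (fun n => lambda_ R n t) = 0.
  move=> t01; apply: (blim_cvg BL); last exact: lambda_cvg0.
  apply: (@bounded_funI _ _ 1) => k.
  by apply: (le_trans (normr_lambda_le _ t01)) => //; exact: lambda0_le1.
have betaB (t : R) : blim B (fun n => beta_ R n t) = 0 by exact: (banach_limit_cst BL).
split; first by split => //; exact: yosida_hewitt_pure.
move=> lambda beta lambda0 z zeta [lambdaE betaE lambda0E yh].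
apply: degenerate_generalized_limit => //.
- by move=> t t01; rewrite -lambdaE// lambdaB.
- by move=> t t01; rewrite -betaE// betaB.
- by rewrite -lambda0E.
Qed.

(** Limits along the tails persist along the finer filter [F], and limits in R are unique, so
    [lambda], [beta] and [lambda0] are the ordinary limits 0; for the measures, the limit along [F]
    is a cluster point. *)
Lemma subnet_generalized_limit_degenerate (F : set_system nat) (Phi : Linf R -> R) w :
  subnet F -> weakstar_cvg F (@int_mu R) Phi -> represents w Phi ->
  subnet_generalized_limit F w (fun=> 0) (fun=> 0) 0 (fun=> 0) w /\
  forall (lambda beta : R -> R) (lambda0 : R) (z : R -> R) zeta,
    subnet_generalized_limit F w lambda beta lambda0 z zeta ->
    [/\ degenerate lambda beta lambda0 z zeta,
        trivial_multipliers w lambda beta lambda0 z zeta &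
        pure_at_origin w].
Proof.
move=> sF cPhi rep; have [PF Foo] := sF.
have pw := cluster_charge_pure (weakstar_cvg_cluster sF cPhi) (represents_indL rep).
have FE (u : nat -> R) (l : R) : u @ \oo --> l -> u @ F --> l.
  by move=> ul A /ul uA; exact: Foo.
have uniq (u : nat -> R) (l : R) : u @ \oo --> (0 : R) -> u @ F --> l -> l = 0.
  by move=> /FE u0 ul; exact: (cvg_unique (@Rhausdorff R) ul u0).
have beta0 (t : R) : (fun n => beta_ R n t) @ \oo --> (0 : R) by exact: cvg_cst.
split.
  split; [|by move=> t _; exact: FE| |exact: yosida_hewitt_pure].
    by move=> t t01; apply: FE; exact: lambda_cvg0.
  by apply: FE; exact: lambda0_cvg0.
move=> lambda beta lambda0 z zeta [lambdaE betaE lambda0E yh].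
apply: degenerate_generalized_limit => //.
- by move=> t t01; exact: (uniq _ _ (lambda_cvg0 t01) (lambdaE t t01)).
- by move=> t t01; exact: (uniq _ _ (beta0 t) (betaE t t01)).
- exact: (uniq _ _ (@lambda0_cvg0 R) lambda0E).
Qed.

Lemma weakstar_cluster_represented (Phi : Linf R -> R) :
  weakstar_cluster (@int_mu R) Phi ->
  exists2 w : {additive_charge set (lebT R) -> \bar R},
    represents w Phi & pure_at_origin w.
Proof.
move=> cPhi; have [dPhi _] := cPhi.
have [w wE] := Lfun_dual_charge_exists dPhi.
by exists w; [exact: Lfun_dual_represents|exact: cluster_charge_pure cPhi wE].
Qed.

End generalized_limits.

Theorem proposition3p9 (R : realType) :
  (* the multipliers of the truncated problems *)
  (forall n : nat, (2 <= n)%N ->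
     [/\ a_ R n = ln n%:R - 1 + n%:R^-1,
         unique_minimizer (n%:R^-1) (fun t : R => t ^+ 2 / 2) (fun t : R => t),
         regular_multipliers (n%:R^-1) (fun t : R => t)
           (lambda0_ R n) (lambda_ R n) (z_ R n),
         ((lambda0_ R n)%:E
           + 'N[lebI (n%:R^-1 : R) 1]_1[EFin \o z_ R n] = 1)%E &
         forall (l0 : R) (l z : R -> R),
           regular_multipliers (n%:R^-1) (fun t : R => t) l0 l z ->
           (l0%:E + 'N[lebI (n%:R^-1 : R) 1]_1[EFin \o z] = 1)%E ->
           [/\ l0 = lambda0_ R n,
               forall t, n%:R^-1 <= t <= 1 -> l t = lambda_ R n t &
               \forall t \ae lebI (n%:R^-1 : R) 1, z t = z_ R n t]]) /\
  (* their asymptotics *)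
  (forall n : nat, (2 <= n)%N ->
     [/\ lambda0_ R n = (ln n%:R + n%:R^-1)^-1,
         ('N[leb01 R]_+oo[EFin \o lambda_ R n]
           = (lambda0_ R n * (1 - n%:R^-1))%:E)%E &
         z_ R n \in Lfun (leb01 R) 1%E]) /\
  (lambda0_ R @ \oo --> (0 : R)) /\
  ((fun n => 'N[leb01 R]_+oo[EFin \o lambda_ R n])%E @ \oo --> 0%E) /\
  ((fun n => 'N[leb01 R]_1[EFin \o z_ R n])%E @ \oo --> 1%E) /\
  (forall e : R, 0 < e < 1 ->
     [/\ forall n : nat, (2 <= n)%N ->
           (mu_ R n (`[e, 1%R]%classic : set R)
              <= (lambda0_ R n * ln (1 / e)%R)%:E)%E,
         (fun n => lambda0_ R n * ln (1 / e)) @ \oo --> (0 : R) &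
         (fun n => mu_ R n (`[e, 1]%classic : set R)) @ \oo --> 0%E]) /\
  (* (i) *)
  (forall phi : nat -> nat, {homo phi : i j / (i < j)%N} ->
     (forall k, (2 <= phi k)%N) ->
     ~ exists f : R -> R, weak_cvg_L1 (fun k => z_ R (phi k)) f) /\
  (* (ii) *)
  ((forall phi : R -> R, {within `[0, 1]%classic, continuous phi} ->
      (fun n => \int[mu_ R n]_(t in (`[0, 1]%classic : set R)) phi t) @ \oo -->
      \int[\d_((0 : R) : lebT R)]_(t in (`[0, 1]%classic : set R)) phi t) /\
   ~ (\d_((0 : R) : lebT R) `<< leb01 R)) /\
  (* (iii) *)
  (~ (exists Phi : Linf R -> R, weakstar_cvg \oo int_mu Phi) /\
   forall c : R, - (Num.sqrt 2 / 2) <= c <= Num.sqrt 2 / 2 ->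
     cluster ((fun n => \int[mu_ R n]_(t in (`[0, 1]%classic : set R))
                          sin (ln (ln (expR 1 / t)))) @ \oo) c) /\
  (* (iv) *)
  (forall B : (nat -> R) -> R, banach_limit B ->
     exists2 w : {additive_charge set (lebT R) -> \bar R},
       banach_charge B w & pure_at_origin w) /\
  (forall Phi : Linf R -> R, weakstar_cluster int_mu Phi ->
     exists2 w : {additive_charge set (lebT R) -> \bar R},
       represents w Phi & pure_at_origin w) /\
  (* generalized limits of the multipliers *)
  (forall (B : (nat -> R) -> R) (w : {additive_charge set (lebT R) -> \bar R}),
     banach_limit B -> banach_charge B w ->
     banach_generalized_limit B w (fun=> 0) (fun=> 0) 0 (fun=> 0) w /\
     forall (lambda beta : R -> R) (lambda0 : R) (z : R -> R)
         (zeta : {additive_charge set (lebT R) -> \bar R}),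
       banach_generalized_limit B w lambda beta lambda0 z zeta ->
       [/\ degenerate lambda beta lambda0 z zeta,
           trivial_multipliers w lambda beta lambda0 z zeta &
           pure_at_origin w]) /\
  (forall (F : set_system nat) (Phi : Linf R -> R)
       (w : {additive_charge set (lebT R) -> \bar R}),
     subnet F -> weakstar_cvg F int_mu Phi -> represents w Phi ->
     subnet_generalized_limit F w (fun=> 0) (fun=> 0) 0 (fun=> 0) w /\
     forall (lambda beta : R -> R) (lambda0 : R) (z : R -> R)
         (zeta : {additive_charge set (lebT R) -> \bar R}),
       subnet_generalized_limit F w lambda beta lambda0 z zeta ->
       [/\ degenerate lambda beta lambda0 z zeta,
           trivial_multipliers w lambda beta lambda0 z zeta &
           pure_at_origin w]).
Proof.
split.
  move=> n n2; have n01 := invn_itv R n2; have /andP[n0 n1] := n01.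
  split.
  - exact: a_E.
  - exact: unique_minimizer_id.
  - exact: regular_multipliers_truncated.
  - by rewrite Lnorm1_z_lebI// -EFinD addrC subrK.
  - exact: regular_multipliers_unique.
split; first by move=> n n2; split; [exact: lambda0_E|exact: Lnorm_infty_lambda|exact: Lfun1_z].
split; first exact: lambda0_cvg0.
split; first exact: Lnorm_infty_lambda_cvg0.
split; first exact: Lnorm1_z_cvg1.
split.
  move=> e e01; split; first by move=> n n2; exact: mu_tail_le.
    exact: lambda0_mulr_cvg0.
  exact: mu_tail_cvg0.
split; first exact: z_not_weakly_cvg.
split; first by split; [exact: mu_weakstar_dirac|exact: dirac_not_dominated].
split; first by split; [exact: weakstar_not_cvg|exact: cluster_psi].
split.
  move=> B BL; have [w wB] := banach_charge_exists BL.
  by exists w; [|exact: (banach_charge_pure BL wB)].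
split; first exact: weakstar_cluster_represented.
split; first exact: banach_generalized_limit_degenerate.
exact: subnet_generalized_limit_degenerate.
Qed.
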